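(* Let $F$ be a field of prime characteristic $p$ and let $\mathfrak{L}_F$ be a Chevalley algebra over $F$ of exceptional type, i.e. of one of the types $\mathfrak{g}_2,\mathfrak{f}_4,\mathfrak{e}_6,\mathfrak{e}_7,\mathfrak{e}_8$. Then the derivations of $\mathfrak{L}_F$ are all inner, i.e. $\mathrm{Der}(\mathfrak{L}_F)=\mathrm{ad}(\mathfrak{L}_F)$, except in the following cases: type $\mathfrak{g}_2$ with $p=2$, type $\mathfrak{e}_6$ with $p=3$, and type $\mathfrak{e}_7$ with $p=2$ (in these three cases not all derivations are inner).
   Context: Chevalley algebras. Let $k$ be an algebraically closed field of characteristic $0$, $\mathfrak{L}$ a finite-dimensional semisimple Lie algebra over $k$, $H$ a Cartan subalgebra, $\Phi$ the root system, $\alpha_1,\dots,\alpha_r$ simple roots, $\langle\alpha,\beta\rangle=2(\alpha,\beta)/(\beta,\beta)$. A Chevalley basis of $\mathfrak{L}$ is a basis $\{v_\alpha\}_{\alpha\in\Phi}\cup\{h_i\}_{i=1}^r$ with $h_i\in H$ and $v_\alpha$ in the root space of $\alpha$, such that: $[h_i,h_j]=0$; $[h_i,v_\alpha]=\langle\alpha,\alpha_i\rangle v_\alpha$; $[v_\alpha,v_{-\alpha}]=h_\alpha$ is a $\mathbb{Z}$-linear combination of $h_1,\dots,h_r$, with $h_{\alpha_i}=h_i$; and for linearly independent roots $\alpha,\beta$ with $\alpha$-string $\beta-s\alpha,\dots,\beta+q\alpha$ through $\beta$, $[v_\alpha,v_\beta]=0$ if $q=0$ and $[v_\alpha,v_\beta]=\pm(s+1)v_{\alpha+\beta}$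 if $\alpha+\beta\in\Phi$. Let $\mathfrak{L}_{\mathbb{Z}}$ be the $\mathbb{Z}$-span of a Chevalley basis, a Lie algebra over $\mathbb{Z}$. For a field $F$ of prime characteristic, the Chevalley algebra is $\mathfrak{L}_F=\mathfrak{L}_{\mathbb{Z}}\otimes_{\mathbb{Z}}F$; up to isomorphism it depends only on $\mathfrak{L}$ and $F$. If $\mathfrak{L}$ is simple with Dynkin diagram $D$, then $\mathfrak{L}_F$ is said to be of type $D$; the types $\mathfrak{g}_2,\mathfrak{f}_4,\mathfrak{e}_6,\mathfrak{e}_7,\mathfrak{e}_8$ correspond to the diagrams $G_2,F_4,E_6,E_7,E_8$. For a Lie algebra $L$ over $F$, $\mathrm{Der}(L)$ is the Lie algebra of $F$-linear derivations and $\mathrm{ad}(L)=\{\mathrm{ad}(x):x\in L\}$, $\mathrm{ad}(x)(y)=[x,y]$, is the ideal of inner derivations. *)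

(* Defs.v *)
From mathcomp Require Import all_boot all_order all_algebra.

Set Implicit Arguments.
Unset Strict Implicit.
Unset Printing Implicit Defensive.

Import Order.TTheory GRing.Theory Num.Theory.
Local Open Scope ring_scope.

Section LieAlgebra.

Variables (K : fieldType) (V : lmodType K) (br : V -> V -> V).

Record is_lie_bracket : Prop := IsLieBracket {
  lie_linearl : forall z, linear (br^~ z);
  lie_linearr : forall x, linear (br x);
  lie_alternating : forall x, br x x = 0;
  lie_jacobi : forall x y z, br x (br y z) + br y (br z x) + br z (br x y) = 0 }.

Definition is_derivation (D : V -> V) : Prop :=
  linear D /\ forall x y, D (br x y) = br (D x) y + br x (D y).

Definition is_inner (D : V -> V) : Prop := exists x, D =1 br x.

End LieAlgebra.

Section FiniteDimensional.

Variables (k : fieldType) (L : vectType k) (br : L -> L -> L).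

Definition is_ideal (I : {vspace L}) : Prop :=
  forall x y, y \in I -> br x y \in I.

Definition is_simple_lie : Prop :=
  (exists x y, br x y != 0) /\
  forall I : {vspace L}, is_ideal I -> I = 0%VS \/ I = fullv.

Definition is_subalgebra (U : {vspace L}) : Prop :=
  forall x y, x \in U -> y \in U -> br x y \in U.

Definition brv (U W : {vspace L}) : {vspace L} :=
  <<[seq br x y | x <- vbasis U, y <- vbasis W]>>%VS.

Definition is_nilpotent (U : {vspace L}) : Prop :=
  exists n, iter n (brv U) U = 0%VS.

Definition is_cartan (H : {vspace L}) : Prop :=
  [/\ is_subalgebra H, is_nilpotent H &
      forall x, (forall y, y \in H -> br x y \in H) -> x \in H].

Definition lfun_tr (f : 'End(L)) : k :=
  \tr (passmx.mxof (vbasis fullv) (vbasis fullv) f).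

Definition killing (x y : L) : k :=
  lfun_tr (linfun (br x) \o linfun (br y))%VF.

Section Roots.

Variable H : {vspace L}.

Definition dual := 'Hom(subvs_of H, k^o).

Definition in_root_space (a : dual) (x : L) : Prop :=
  forall y : subvs_of H, br (vsval y) x = (a y : k) *: x.

Definition is_root (a : dual) : Prop :=
  a != 0 /\ exists2 x, x != 0 & in_root_space a x.

Definition is_root_system (Phi : seq dual) : Prop :=
  uniq Phi /\ forall a, is_root a <-> a \in Phi.

Definition killing_flat : 'Hom(subvs_of H, dual) :=
  linfun (fun x : subvs_of H =>
    linfun (fun y : subvs_of H => killing (vsval x) (vsval y) : k^o) : dual).

(* The element t_a of H with killing t_a y = a y for all y in H: when br is
   semisimple and H is Cartan, killing_flat is bijective. *)
Definition killing_vec (a : dual) : subvs_of H := (killing_flat^-1)%VF a.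

(* The form on the dual of H transported from the Killing form. *)
Definition form (a b : dual) : k :=
  killing (vsval (killing_vec a)) (vsval (killing_vec b)).

Definition cartan_int (a b : dual) : k := 2%:R * form a b / form b b.

Definition is_base (Phi : seq dual) (r : nat) (alpha : r.-tuple dual) : Prop :=
  [/\ {subset alpha <= Phi}, free alpha &
      forall b, b \in Phi -> exists c : 'I_r -> nat,
        b = \sum_i tnth alpha i *+ c i \/ b = - \sum_i tnth alpha i *+ c i].

(* The a-string through b is b - s a, ..., b + q a. *)
Definition is_string (Phi : seq dual) (a b : dual) (s q : nat) : Prop :=
  [/\ forall i, (i <= s)%N -> b - a *+ i \in Phi,
      forall i, (i <= q)%N -> b + a *+ i \in Phi,
      b - a *+ s.+1 \notin Phi & b + a *+ q.+1 \notin Phi].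

(* Only the values of v on Phi matter. *)
Record is_chevalley_basis (Phi : seq dual) (r : nat) (alpha : r.-tuple dual)
    (v : dual -> L) (h : r.-tuple L) : Prop := IsChevalleyBasis {
  chev_basis : basis_of fullv (map v Phi ++ h);
  chev_cartan : forall i, tnth h i \in H;
  chev_root : forall a, a \in Phi -> in_root_space a (v a);
  chev_hh : forall i j, br (tnth h i) (tnth h j) = 0;
  chev_hv : forall i a, a \in Phi ->
    br (tnth h i) (v a) = cartan_int a (tnth alpha i) *: v a;
  chev_opp : forall a, a \in Phi -> inIntSpan h (br (v a) (v (- a)));
  chev_simple : forall i,
    br (v (tnth alpha i)) (v (- tnth alpha i)) = tnth h i;
  chev_string : forall a b s q, a \in Phi -> b \in Phi -> free [:: a; b] ->
    is_string Phi a b s q ->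
    (q = 0%N -> br (v a) (v b) = 0) /\
    (a + b \in Phi ->
       br (v a) (v b) = s.+1%:R *: v (a + b) \/
       br (v a) (v b) = - (s.+1%:R *: v (a + b))) }.

(* Lengths of roots are compared through rational ratios, since k is not
   ordered. *)
Definition longer (a b : dual) : Prop :=
  exists2 q : rat, 1 < q & form a a = ratr q * form b b.

End Roots.

End FiniteDimensional.

Inductive exceptional_type := G2 | F4 | E6 | E7 | E8.

Definition dynkin_rank (D : exceptional_type) : nat :=
  match D with G2 => 2 | F4 => 4 | E6 => 6 | E7 => 7 | E8 => 8 end.

(* (i, j, m) stands for m edges joining i and j, with an arrow from i to j
   (from the long root to the short one) when m > 1. Bourbaki's labelling,
   shifted by one. *)
Definition dynkin_edges (D : exceptional_type) : seq (nat * nat * nat) :=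
  match D with
  | G2 => [:: (1, 0, 3)]
  | F4 => [:: (0, 1, 1); (1, 2, 2); (2, 3, 1)]
  | E6 => [:: (0, 2, 1); (2, 3, 1); (3, 4, 1); (4, 5, 1); (1, 3, 1)]
  | E7 => [:: (0, 2, 1); (2, 3, 1); (3, 4, 1); (4, 5, 1); (5, 6, 1);
              (1, 3, 1)]
  | E8 => [:: (0, 2, 1); (2, 3, 1); (3, 4, 1); (4, 5, 1); (5, 6, 1);
              (6, 7, 1); (1, 3, 1)]
  end%N.

Definition dynkin_mult (D : exceptional_type) (i j : nat) : nat :=
  \sum_(e <- dynkin_edges D | (e.1 == (i, j)) || (e.1 == (j, i))) e.2.

Definition dynkin_arrow (D : exceptional_type) (i j : nat) : bool :=
  has (fun e => (e.1 == (i, j)) && (1 < e.2)%N) (dynkin_edges D).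

Definition has_dynkin_diagram (k : fieldType) (L : vectType k)
    (br : L -> L -> L) (H : {vspace L}) (r : nat) (alpha : r.-tuple (dual H))
    (D : exceptional_type) : Prop :=
  exists2 f : 'I_r -> 'I_(dynkin_rank D), bijective f &
    forall i j, i != j ->
      let ai := tnth alpha i in let aj := tnth alpha j in
      cartan_int br ai aj * cartan_int br aj ai
        = (dynkin_mult D (f i) (f j))%:R /\
      (dynkin_arrow D (f i) (f j) <->
       form br ai aj != 0 /\ longer br ai aj).

(* f is only constrained at first arguments in the subgroup S of M: it stands
   for a map S -> N -> A. *)
Definition biadditive_on (M N A : zmodType) (S : M -> Prop)
    (f : M -> N -> A) : Prop :=
  (forall x y a, S x -> S y -> f (x + y) a = f x a + f y a) /\
  (forall x a b, S x -> f x (a + b) = f x a + f x b).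

(* t exhibits T as the tensor product of S and N over the integers, through
   its universal property; the last clause is uniqueness of the factorization. *)
Definition is_tensor (M N T : zmodType) (S : M -> Prop)
    (t : M -> N -> T) : Prop :=
  biadditive_on S t /\
  forall (A : zmodType) (f : M -> N -> A), biadditive_on S f ->
    (exists g : {additive T -> A}, forall x a, S x -> g (t x a) = f x a) /\
    (forall g1 g2 : {additive T -> A},
       (forall x a, S x -> g1 (t x a) = g2 (t x a)) -> g1 =1 g2).

(* LF, with bracket brF and pure tensors t x a, is the Lie algebra over F
   obtained from the Lie ring S (a subring of (L, br)) by extension of scalars
   to F. *)
Record is_lie_base_change (L : zmodType) (br : L -> L -> L) (S : L -> Prop)
    (F : fieldType) (LF : lmodType F) (brF : LF -> LF -> LF)
    (t : L -> F -> LF) : Prop := IsLieBaseChange {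
  base_change_tensor : is_tensor S t;
  base_change_scale : forall x a c, S x -> c *: t x a = t x (c * a);
  base_change_lie : is_lie_bracket brF;
  base_change_br : forall x y a b, S x -> S y ->
    brF (t x a) (t y b) = t (br x y) (a * b) }.

Definition is_chevalley_algebra (k : fieldType) (L : vectType k)
    (br : L -> L -> L) (H : {vspace L}) (Phi : seq (dual H)) (r : nat)
    (v : dual H -> L) (h : r.-tuple L) (F : fieldType) (LF : lmodType F)
    (brF : LF -> LF -> LF) : Prop :=
  exists t : L -> F -> LF,
    is_lie_base_change br (inIntSpan (in_tuple (map v Phi ++ h))) brF t.

Definition exceptional_case (D : exceptional_type) (p : nat) : bool :=
  match D with
  | G2 => p == 2%N
  | E6 => p == 3%N
  | E7 => p == 2%N
  | F4 | E8 => false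
  end.

(* Main.v *)
Require Import Defs.
From HB Require Import structures.
From Stdlib Require Import ClassicalEpsilon.
From mathcomp Require Import all_boot all_order all_algebra.
From mathcomp Require Import ring.
Local Open Scope ring_scope.

(* In characteristic 0, the trace of [e, f] on a string of root vectors is zero,
   which gives b(h_i) = s - q for the a_i-string through b. Hence the roots are
   closed under simple reflections, and they are identified with the explicit
   root vectors of the root lattice Q; the nondegeneracy of the Killing form is
   not needed.

   Over F, let D be a derivation, and suppose that the Cartan matrix is
   invertible modulo p. Then an element of Q which vanishes on the Cartan part H
   lies in p Q, and no root lies in p Q. Subtracting first the inner derivation
   of a combination of root vectors, then that of an element of H, one may
   assume that D kills H, that D V_a is a combination of the V_b with b = a
   modulo p Q, and that the coefficient of V_a in D V_a is 0 for a simple. If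
   b <> a, there is a root x such that b + x is a root but none of x - b, a + x
   (which is not 0 either) and x + b - a is; then [V_b, V_x] = +- V_(b + x), and
   applying D to [V_a, V_x] = 0 shows that V_b does not occur in D V_a. The
   diagonal coefficients are additive, hence 0, by induction on the height.

   For E6 with p = 3 and E7 with p = 2, the Cartan matrix is singular modulo p
   and Q has gradings with values in F that H does not induce. For G2 with
   p = 2, the signs of the structure constants do not matter, and
   V_a |-> V_(a + 2 a_1), restricted to four roots a, is an outer derivation. *)
Set Implicit Arguments.
Unset Strict Implicit.
Unset Printing Implicit Defensive.

Import Order.TTheory GRing.Theory Num.Theory.

(** * Positive roots of the exceptional types *)

(** The exceptions have two sources. The determinant of the Cartan matrix is 3 for E6, 2 for E7 and
    1 for the other types, so that only E6 with p = 3 and E7 with p = 2 lose the passage from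
    weights on H to classes modulo p Q. Type G2 with p = 2 keeps it; what fails there is the choice
    of x: none exists for a = a_2 and b = 2 a_1 + a_2, a pair that the outer derivation joins. The
    obstacle on the way is that Phi is given abstractly. It becomes explicit by a uniqueness
    principle: since the inverse Cartan matrix has nonnegative entries, every nonzero nonnegative
    vector pairs positively with some simple coroot, so that a set of such vectors which contains
    the simple roots and is closed under simple reflections, except at the simple root itself, is
    determined by the matrix. The computed list and the positive part of Phi are both such sets. The
    facts about the list are checked by computation on sequences of integers; for the choice of x,
    reflections reduce the check to b simple. *)

Definition cartan_entry (X : exceptional_type) (i j : nat) : int :=
  if i == j then 2 else if dynkin_arrow X j i then -1 else
  - (sumn [seq e.2 | e <- dynkin_edges X & (e.1 == (i, j)) || (e.1 == (j, i))])%:Z.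

Definition cartan_det (X : exceptional_type) : nat :=
  match X with E6 => 3 | E7 => 2 | _ => 1 end.

(** The adjugate of the Cartan matrix, that is [cartan_det] times its inverse. Its entries can be
    natural numbers because the inverse of a Cartan matrix of finite type is nonnegative. *)
Definition adj_table (X : exceptional_type) : seq (seq nat) :=
  match X with
  | G2 => [:: [:: 2; 1]; [:: 3; 2]]
  | F4 => [:: [:: 2; 3; 4; 2]; [:: 3; 6; 8; 4]; [:: 2; 4; 6; 3];
              [:: 1; 2; 3; 2]]
  | E6 => [:: [:: 4; 3; 5; 6; 4; 2]; [:: 3; 6; 6; 9; 6; 3];
              [:: 5; 6; 10; 12; 8; 4]; [:: 6; 9; 12; 18; 12; 6];
              [:: 4; 6; 8; 12; 10; 5]; [:: 2; 3; 4; 6; 5; 4]]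
  | E7 => [:: [:: 4; 4; 6; 8; 6; 4; 2]; [:: 4; 7; 8; 12; 9; 6; 3];
              [:: 6; 8; 12; 16; 12; 8; 4]; [:: 8; 12; 16; 24; 18; 12; 6];
              [:: 6; 9; 12; 18; 15; 10; 5]; [:: 4; 6; 8; 12; 10; 8; 4];
              [:: 2; 3; 4; 6; 5; 4; 3]]
  | E8 => [:: [:: 4; 5; 7; 10; 8; 6; 4; 2]; [:: 5; 8; 10; 15; 12; 9; 6; 3];
              [:: 7; 10; 14; 20; 16; 12; 8; 4];
              [:: 10; 15; 20; 30; 24; 18; 12; 6];
              [:: 8; 12; 16; 24; 20; 15; 10; 5];
              [:: 6; 9; 12; 18; 15; 12; 8; 4];
              [:: 4; 6; 8; 12; 10; 8; 6; 3]; [:: 2; 3; 4; 6; 5; 4; 3; 2]]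
  end.

Definition adj_entry X i j : int := (nth 0%N (nth [::] (adj_table X) i) j)%:Z.

Section Lists.
Variable X : exceptional_type.
Let n := dynkin_rank X.

Definition suml (s : seq int) : int := foldr (fun x y => x + y) 0 s.
Definition addl (s t : seq int) := mkseq (fun i => s`_i + t`_i) n.
Definition oppl (s : seq int) := mkseq (fun i => - s`_i) n.
Definition simplel (i : nat) : seq int := mkseq (fun j => (j == i)%:Z) n.
Definition zerol : seq int := nseq n 0.
Definition pairl (s : seq int) (i : nat) : int :=
  suml (mkseq (fun j => s`_j * cartan_entry X j i) n).
Definition refll (s : seq int) (i : nat) : seq int :=
  mkseq (fun j => if j == i then s`_j - pairl s i else s`_j) n.
Definition nonneg (s : seq int) := all (fun c : int => 0 <= c) s.

(** Breadth-first closure under simple reflections. The fuel used below is h - 2, with h the Coxeter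
    number: the highest root has height h - 1, and each step down to a simple root lowers the height
    by at least 1. Completeness is tested afterwards by [check_closed]. *)
Fixpoint grow_roots (k : nat) (seen front : seq (seq int)) :=
  if k is k'.+1 then
    let new := undup [seq y <- [seq refll s i | s <- front, i <- iota 0 n]
                     | nonneg y && (y \notin seen)] in
    grow_roots k' (seen ++ new) new
  else seen.
End Lists.

Definition positive_roots_g2 : seq (seq int) := Eval vm_compute in
  let s := mkseq (simplel G2) 2 in grow_roots G2 4 s s.
Definition positive_roots_f4 : seq (seq int) := Eval vm_compute in
  let s := mkseq (simplel F4) 4 in grow_roots F4 10 s s.
Definition positive_roots_e6 : seq (seq int) := Eval vm_compute in
  let s := mkseq (simplel E6) 6 in grow_roots E6 10 s s.
Definition positive_roots_e7 : seq (seq int) := Eval vm_compute in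
  let s := mkseq (simplel E7) 7 in grow_roots E7 16 s s.
Definition positive_roots_e8 : seq (seq int) := Eval vm_compute in
  let s := mkseq (simplel E8) 8 in grow_roots E8 28 s s.

Definition positive_roots (X : exceptional_type) : seq (seq int) :=
  match X with
  | G2 => positive_roots_g2
  | F4 => positive_roots_f4
  | E6 => positive_roots_e6
  | E7 => positive_roots_e7
  | E8 => positive_roots_e8
  end.

Definition root_list (X : exceptional_type) : seq (seq int) :=
  positive_roots X ++ map (oppl X) (positive_roots X).

Definition check_adj X :=
  let n := dynkin_rank X in
  all (fun i => all (fun j =>
    (suml (mkseq (fun k => cartan_entry X i k * adj_entry X k j) n)
       == (if i == j then (cartan_det X)%:Z else 0)) &&
    (suml (mkseq (fun k => adj_entry X i k * cartan_entry X k j) n)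
       == (if i == j then (cartan_det X)%:Z else 0))) (iota 0 n)) (iota 0 n).

Definition check_closed X :=
  let n := dynkin_rank X in
  [&& uniq (positive_roots X),
      all (fun s => (size s == n) && nonneg s) (positive_roots X),
      all (fun i => simplel X i \in positive_roots X) (iota 0 n) &
      all (fun s => all (fun i =>
        (s == simplel X i) || (refll X s i \in positive_roots X)) (iota 0 n))
      (positive_roots X)].

(** The last condition bounds the string of [s] through the negative of the simple root, which is
    what [weight_add] asks for when that root is subtracted from [s]. *)
Definition check_descent X :=
  let n := dynkin_rank X in
  all (fun s =>
    has (fun i => s == simplel X i) (iota 0 n) ||
    has (fun i => (addl X s (oppl X (simplel X i)) \in positive_roots X) &&
      ((addl X s (simplel X i) \notin root_list X) ||
       (if X is G2 then true else false) &&
       (addl X (addl X s s) (simplel X i) \notin root_list X))) (iota 0 n))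
  (positive_roots X).

Definition gcdl (s : seq int) : nat := foldr (fun x d => gcdn `|x|%N d) 0%N s.

(* Nested conditionals rather than [&&] and [||], which [vm_compute] evaluates
   strictly. *)
Definition detectl X (a b : seq int) :=
  has (fun x =>
    if addl X b x \in root_list X then
      if addl X x (oppl X b) \in root_list X then false else
      if addl X a x \in zerol X :: root_list X then false else
      addl X x (addl X b (oppl X a)) \notin root_list X
    else false) (root_list X).

(** Only roots congruent to the simple root modulo a prime p matter, and p then divides [g]: so
    [g = 1] is skipped, and in type G2 [g = 2] leaves only the excluded p = 2. *)
Definition check_detect X :=
  all (fun i => all (fun a =>
    if a == simplel X i then true else
    let g := gcdl (addl X (simplel X i) (oppl X a)) in
    if g == 1%N then true else
    if (if X is G2 then g == 2%N else false) then true else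
    detectl X a (simplel X i)) (root_list X)) (iota 0 (dynkin_rank X)).

Definition check_root_list X :=
 [&& check_adj X, check_closed X, check_descent X & check_detect X].

Lemma root_list_checked X : check_root_list X.
Proof. by case: X; vm_compute. Qed.

Section Rows.
Variables (n : nat).
Implicit Types (x y : 'rV[int]_n).

Lemma rowZE c x j : (c *: x) 0 j = c * x 0 j. Proof. by rewrite mxE. Qed.
Lemma rowNE x j : (- x) 0 j = - x 0 j. Proof. by rewrite mxE. Qed.
Lemma rowDE x y j : (x + y) 0 j = x 0 j + y 0 j. Proof. by rewrite mxE. Qed.
End Rows.

(** * Positive systems *)

Section PositiveSystems.
Variables (n : nat) (A : 'M[int]_n).

(** For the Cartan matrix with entries <a_i, a_j>, this is <x, a_i>. Hence an arrow from j to i,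
    which makes a_j the longer root, gives the entry -1 at (i, j) in [cartan_entry]. *)
Definition pairing (x : 'rV[int]_n) (i : 'I_n) : int := (x *m A) 0 i.
Definition simple (i : 'I_n) : 'rV[int]_n := delta_mx 0 i.
Definition reflection (i : 'I_n) (x : 'rV[int]_n) := x - pairing x i *: simple i.

Lemma pairingD x y i : pairing (x + y) i = pairing x i + pairing y i.
Proof. by rewrite /pairing mulmxDl mxE. Qed.

Lemma pairingN x i : pairing (- x) i = - pairing x i.
Proof. by rewrite /pairing mulNmx mxE. Qed.

Lemma pairingZ c x i : pairing (c *: x) i = c * pairing x i.
Proof. by rewrite /pairing -scalemxAl mxE. Qed.

Lemma pairing_simple i j : pairing (simple i) j = A i j.
Proof. by rewrite /pairing /simple -rowE mxE. Qed.

Lemma simpleE i j : simple i 0 j = (j == i)%:R.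
Proof. by rewrite mxE eqxx. Qed.

Lemma simple_diag i : simple i 0 i = 1.
Proof. by rewrite simpleE eqxx. Qed.

Lemma reflectionD i x y : reflection i (x + y) = reflection i x + reflection i y.
Proof. by rewrite /reflection pairingD scalerDl opprD addrACA. Qed.

Lemma reflectionZ i c x : reflection i (c *: x) = c *: reflection i x.
Proof. by rewrite /reflection pairingZ scalerBr scalerA. Qed.

Lemma reflectionN i x : reflection i (- x) = - reflection i x.
Proof. by rewrite -!scaleN1r reflectionZ. Qed.

Lemma reflection0 i : reflection i 0 = 0.
Proof. by rewrite -(scale0r 0) reflectionZ !scale0r. Qed.

Lemma reflectionE i x j :
  reflection i x 0 j = x 0 j - (if j == i then pairing x i else 0).
Proof. by rewrite !mxE eqxx /=; case: eqP => _; rewrite ?mulr1 ?mulr0. Qed.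

Hypothesis A_diag : forall i, A i i = 2.

Lemma reflectionK i : involutive (reflection i).
Proof.
move=> x; rewrite {1}/reflection.
have -> : pairing (reflection i x) i = - pairing x i.
  by rewrite /reflection pairingD pairingN pairingZ pairing_simple A_diag mulr2n
             mulrDr mulr1 opprD addrA subrr add0r.
by rewrite scaleNr opprK subrK.
Qed.

Lemma reflection_simple i : reflection i (simple i) = - simple i.
Proof.
by rewrite /reflection pairing_simple A_diag scaler_nat mulr2n opprD addrA subrr
           sub0r.
Qed.

Variables (B : 'M[int]_n) (d : int).
Hypotheses (d_gt0 : 0 < d) (AB : A *m B = d%:M) (B_ge0 : forall i j, 0 <= B i j).

Lemma pairing_adj x j : \sum_i pairing x i * B i j = d * x 0 j.
Proof.
have /matrixP/(_ 0 j) : x *m A *m B = d *: x by rewrite -mulmxA AB mul_mx_scalar.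
by rewrite !mxE => <-; apply: eq_bigr => i _.
Qed.

(** These properties determine the set of positive roots: see [positive_unique]. The last one leaves
    out [simple i], whose reflection is its negative. *)
Definition positive_system (P : 'rV[int]_n -> Prop) :=
  [/\ forall i, P (simple i),
      forall x, P x -> x != 0 /\ forall j, 0 <= x 0 j &
      forall x i, P x -> x != simple i -> P (reflection i x)].

(** If all pairings were nonpositive, multiplying by the nonnegative matrix [B] would make [d] times
    each coordinate nonpositive, so that [x] would be 0. *)
Lemma positive_pairing (x : 'rV[int]_n) : x != 0 -> (forall j, 0 <= x 0 j) ->
  exists i, 0 < pairing x i.
Proof.
move=> x0 x_ge0; apply/existsP; apply: contraNT x0 => /existsPn x_le.
apply/eqP/rowP => j; rewrite mxE; apply/eqP; rewrite eq_le x_ge0 andbT.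
rewrite -(pmulr_rle0 _ d_gt0) -pairing_adj; apply: sumr_le0 => i _.
by rewrite mulr_le0_ge0 // leNgt x_le.
Qed.

(* Induction on the height, which a reflection in a simple root with positive
   pairing lowers. *)
Lemma positive_system_ind (P Q : 'rV[int]_n -> Prop) : positive_system P ->
  (forall i, Q (simple i)) ->
  (forall x i, P x -> x != simple i -> Q x -> Q (reflection i x)) ->
  forall x, P x -> Q x.
Proof.
move=> [P1 Ppos Prefl] Q1 Qrefl x.
pose height (y : 'rV[int]_n) : int := \sum_j y 0 j.
have [m] := ubnP `|height x|%N; elim: m x => // m IHm x lexm Px.
have [x0 x_ge0] := Ppos x Px.
have [i xi_gt0] := positive_pairing x0 x_ge0.
have [-> //|x_neq] := eqVneq x (simple i).
have Prx := Prefl x i Px x_neq.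
rewrite -[x](reflectionK i); apply: Qrefl => //.
  apply: contra_neq x_neq => eq_rx.
  have [_ /(_ i)] := Ppos _ Px.
  by rewrite -[x](reflectionK i) eq_rx reflection_simple mxE simpleE eqxx.
apply: IHm => //; have [_ rx_ge0] := Ppos _ Prx.
have sumE : height (reflection i x) = height x - pairing x i.
  rewrite /height.
  under eq_bigr do rewrite reflectionE.
  by rewrite sumrB -big_mkcond big_pred1_eq.
have s_ge0 : 0 <= height x by apply: sumr_ge0.
have rs_ge0 : 0 <= height (reflection i x) by apply: sumr_ge0.
rewrite ltnS in lexm; apply: leq_trans lexm; rewrite -ltz_nat !gez0_abs //.
by rewrite sumE ltrBlDr ltrDl.
Qed.

End PositiveSystems.

(** * The root lattice and its simple reflections *)

Section RootLattice.
Variable X : exceptional_type.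
Local Notation n := (dynkin_rank X).
Local Notation lattice := 'rV[int]_n.

Definition cartan : 'M[int]_n := \matrix_(i, j) cartan_entry X i j.
Definition cartan_adj : 'M[int]_n := \matrix_(i, j) adj_entry X i j.
Definition rowl (s : seq int) : lattice := \row_i s`_i.
Definition root_vectors : seq lattice := map rowl (root_list X).

Local Notation pr := (pairing cartan).
Local Notation refl := (reflection cartan).

Lemma cartan_diag i : cartan i i = 2.
Proof. by rewrite mxE /cartan_entry eqxx. Qed.

Lemma sumlE s : suml s = \sum_(x <- s) x.
Proof. by elim: s => [|x s IHs]; rewrite ?big_nil ?big_cons //= IHs. Qed.

Lemma suml_mkseq f : suml (mkseq f n) = \sum_(i < n) f i.
Proof. by rewrite sumlE big_map -(subn0 n) big_mkord subn0. Qed.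

Lemma allP_iota (P : nat -> bool) :
  reflect (forall i : 'I_n, P i) (all P (iota 0 n)).
Proof.
apply: (iffP allP) => [H i|H i]; first by rewrite H // mem_iota /=.
by rewrite mem_iota => /= lt_in; apply: (H (Ordinal lt_in)).
Qed.

Lemma hasP_iota (P : nat -> bool) :
  reflect (exists i : 'I_n, P i) (has P (iota 0 n)).
Proof.
apply: (iffP hasP) => [[i]|[i Pi]]; last by exists (i : nat); rewrite // mem_iota /=.
by rewrite mem_iota => /= lt_in Pi; exists (Ordinal lt_in).
Qed.

Lemma cartan_mul_adj : cartan *m cartan_adj = (cartan_det X)%:Z%:M.
Proof.
have /and4P[/allP_iota H _ _ _] := root_list_checked X.
apply/matrixP => i j; have /allP_iota/(_ j)/andP[/eqP + _] := H i.
rewrite suml_mkseq !mxE mulrb => <-.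
by apply: eq_bigr => k _; rewrite !mxE.
Qed.

Lemma adj_mul_cartan : cartan_adj *m cartan = (cartan_det X)%:Z%:M.
Proof.
have /and4P[/allP_iota H _ _ _] := root_list_checked X.
apply/matrixP => i j; have /allP_iota/(_ j)/andP[_ /eqP] := H i.
rewrite suml_mkseq !mxE mulrb => <-.
by apply: eq_bigr => k _; rewrite !mxE.
Qed.

Lemma cartan_adj_ge0 i j : 0 <= cartan_adj i j.
Proof. by rewrite mxE. Qed.

Lemma cartan_det_gt0 : 0 < (cartan_det X)%:Z.
Proof. by case: X. Qed.

Lemma nth_simplel i (j : 'I_n) : (simplel X i)`_j = (val j == i)%:Z.
Proof. by rewrite nth_mkseq. Qed.

Lemma rowl_simple (i : 'I_n) : rowl (simplel X i) = simple i.
Proof. by apply/rowP => j; rewrite simpleE mxE nth_simplel natz. Qed.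

Lemma rowl_add s t : rowl (addl X s t) = rowl s + rowl t.
Proof. by apply/rowP => j; rewrite !mxE nth_mkseq. Qed.

Lemma rowl_opp s : rowl (oppl X s) = - rowl s.
Proof. by apply/rowP => j; rewrite !mxE nth_mkseq. Qed.

Lemma rowl_zero : rowl (zerol X) = 0.
Proof. by apply/rowP => j; rewrite !mxE nth_nseq ltn_ord. Qed.

Lemma pairlE s (i : 'I_n) : pairl X s i = pr (rowl s) i.
Proof.
by rewrite /pairl suml_mkseq /pairing mxE; apply: eq_bigr => j _; rewrite !mxE.
Qed.

Lemma rowl_refl s (i : 'I_n) : rowl (refll X s i) = refl i (rowl s).
Proof.
apply/rowP => j; rewrite reflectionE -pairlE !mxE nth_mkseq //.
by rewrite -val_eqE; case: eqP => // _; rewrite subr0.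
Qed.

Lemma rowl_inj s t : size s = n -> size t = n -> rowl s = rowl t -> s = t.
Proof.
move=> sz_s sz_t /rowP eq_st; apply: (@eq_from_nth _ 0) => [|i lt_i]; first by rewrite sz_s.
by rewrite sz_s in lt_i; have := eq_st (Ordinal lt_i); rewrite !mxE.
Qed.

Lemma positive_rootP s : s \in positive_roots X -> size s = n /\ nonneg s.
Proof.
have /and4P[_ /and4P[_ /allP H _ _] _ _] := root_list_checked X.
by move=> /H/andP[/eqP].
Qed.

Lemma size_root s : s \in root_list X -> size s = n.
Proof.
rewrite mem_cat => /orP[/positive_rootP[] //|/mapP[t _ ->]].
by rewrite size_mkseq.
Qed.

Lemma mem_rowl l s : {in l, forall t, size t = n} -> size s = n ->
  (rowl s \in map rowl l) = (s \in l).
Proof.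
move=> sz_l sz_s; apply/mapP/idP => [[t t_in eq_st]|]; last by exists s.
by rewrite (rowl_inj sz_s _ eq_st) ?sz_l.
Qed.

Lemma mem_roots s : size s = n -> (rowl s \in root_vectors) = (s \in root_list X).
Proof. by apply: mem_rowl => t /size_root. Qed.

Definition positive (x : lattice) := x \in map rowl (positive_roots X).

Lemma positive_mem s : size s = n -> positive (rowl s) = (s \in positive_roots X).
Proof. by apply: mem_rowl => t /positive_rootP[]. Qed.

Lemma rootsE x : (x \in root_vectors) = positive x || positive (- x).
Proof.
rewrite /root_vectors map_cat mem_cat -map_comp; congr (_ || _).
apply/mapP/mapP => [] [s s_pos eq_x]; exists s => //.
  by rewrite eq_x /= rowl_opp opprK.
by rewrite /= rowl_opp -eq_x opprK.
Qed.

Lemma rootsN x : (- x \in root_vectors) = (x \in root_vectors).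
Proof. by rewrite !rootsE opprK orbC. Qed.

Lemma positive_simple i : positive (simple i).
Proof.
have /and4P[_ /and4P[_ _ /allP_iota H _] _ _] := root_list_checked X.
by rewrite -rowl_simple positive_mem ?size_mkseq.
Qed.

Lemma simple_root i : simple i \in root_vectors.
Proof. by rewrite rootsE positive_simple. Qed.

Lemma positive_systemP : positive_system cartan positive.
Proof.
have /and4P[_ /and4P[_ _ _ /allP H] _ _] := root_list_checked X.
have ge0 x : positive x -> forall j, 0 <= x 0 j.
  case/mapP => s /positive_rootP[sz_s /allP s_ge0] -> j.
  by rewrite mxE s_ge0 // mem_nth // sz_s.
have reflP x i : positive x -> x != simple i -> positive (refl i x).
  case/mapP => s s_pos -> ; have [sz_s _] := positive_rootP s_pos.
  rewrite -rowl_simple -rowl_refl positive_mem ?size_mkseq //.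
  have /allP_iota/(_ i)/orP[/eqP <-|//] := H _ s_pos.
  by rewrite eqxx.
split=> // [|x x_pos]; first exact: positive_simple.
split; last exact: ge0.
apply: contraL x_pos => /eqP ->.
apply/negP => z_pos; have := z_pos; case/mapP => s s_pos.
have [sz_s _] := positive_rootP s_pos.
rewrite -rowl_zero => /rowl_inj; rewrite size_nseq => /(_ erefl sz_s) eq_s.
by move: s_pos; rewrite -eq_s; case: (X); vm_compute.
Qed.

Lemma positive_ge0 x : positive x -> forall j, 0 <= x 0 j.
Proof. by case: positive_systemP => _ /(_ x) + _ => /[apply] -[]. Qed.

Lemma root_neq0 x : x \in root_vectors -> x != 0.
Proof.
rewrite rootsE; case: positive_systemP => _ H _.
by case/orP => /H[]; rewrite ?oppr_eq0.
Qed.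

Lemma root_reflection x i : x \in root_vectors -> refl i x \in root_vectors.
Proof.
have [_ _ reflP] := positive_systemP.
have H y : positive y -> refl i y \in root_vectors.
  move=> y_pos; have [->|y_neq] := eqVneq y (simple i).
    by rewrite (reflection_simple cartan_diag) rootsN simple_root.
  by rewrite rootsE reflP.
by rewrite rootsE => /orP[/H // | /H]; rewrite reflectionN rootsN.
Qed.

Lemma root_reflectionE x i : (refl i x \in root_vectors) = (x \in root_vectors).
Proof.
apply/idP/idP => [/root_reflection - /(_ i)|]; last exact: root_reflection.
by rewrite (reflectionK cartan_diag).
Qed.

Lemma positive_ind (P Q : lattice -> Prop) : positive_system cartan P ->
  (forall i, Q (simple i)) ->
  (forall x i, P x -> x != simple i -> Q x -> Q (refl i x)) ->
  forall x, P x -> Q x.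
Proof.
exact: (positive_system_ind cartan_diag cartan_det_gt0 cartan_mul_adj
          cartan_adj_ge0).
Qed.

(** Every root is reached from a simple root by simple reflections. The property is carried along
    for [y] and [- y] together, the negative of a simple root being its own reflection. *)
Lemma weyl_ind (Q : lattice -> Prop) :
  (forall i, Q (simple i)) ->
  (forall x i, x \in root_vectors -> Q x -> Q (refl i x)) ->
  forall x, x \in root_vectors -> Q x.
Proof.
move=> Q1 Qrefl x.
suff H y : positive y -> [/\ y \in root_vectors, Q y & Q (- y)].
  by rewrite rootsE => /orP[] /H[]; rewrite ?opprK.
apply: (positive_ind (Q := fun y => [/\ y \in root_vectors, Q y & Q (- y)])
          positive_systemP) => {y} [i|y i _ _ [y_root Qy QNy]].
  split; rewrite ?simple_root // -(reflection_simple cartan_diag).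
  by apply: Qrefl; rewrite ?simple_root.
split; rewrite ?root_reflectionE //; first exact: Qrefl.
by rewrite -reflectionN; apply: Qrefl; rewrite ?rootsN.
Qed.

(** Each of the two systems is generated from the simple roots by reflections under which the other
    is closed. *)
Lemma positive_unique (P : lattice -> Prop) : positive_system cartan P ->
  forall x, P x <-> positive x.
Proof.
move=> psP x; have [P1 _ Prefl] := psP.
have [_ _ posrefl] := positive_systemP.
split; move: x.
  apply: (positive_ind (Q := positive) psP) => [i|x i Px x_neq x_pos]; first exact: positive_simple.
  exact: posrefl.
apply: (positive_ind (Q := P) positive_systemP) => // x i _ x_neq Px.
exact: Prefl.
Qed.
End RootLattice.

Lemma is_G2 X : (if X is G2 then true else false) -> X = G2.
Proof. by case: X. Qed.

Section RootLattice2.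
Variable X : exceptional_type.
Local Notation n := (dynkin_rank X).
Local Notation lattice := 'rV[int]_n.
Local Notation pr := (pairing (cartan X)).
Local Notation refl := (reflection (cartan X)).
Local Notation root_vectors := (root_vectors X).

(** For any other [c], the reflection in [simple i] would produce a positive root with coefficient
    [- c]. *)
Lemma positive_multiple c i : positive (c *: simple i : lattice) -> c = 1.
Proof.
have [_ pos refl_pos] := positive_systemP X.
move=> c_pos; have [|neq] := eqVneq (c *: simple i) (simple i).
  by move/rowP/(_ i); rewrite rowZE simple_diag mulr1.
have [+ /(_ i)] := pos _ c_pos; have [_ /(_ i)] := pos _ (refl_pos _ i c_pos neq).
rewrite reflectionZ (reflection_simple (@cartan_diag X)) !rowZE rowNE simple_diag mulr1 mulrN1.
rewrite oppr_ge0 => c_le0 /negP cN0 c_ge0; case: cN0.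
by have /eqP -> : c == 0; rewrite ?scale0r // eq_le c_le0 c_ge0.
Qed.

Lemma root_multiple c i : (c *: simple i : lattice) \in root_vectors -> c = 1 \/ c = -1.
Proof.
rewrite rootsE -scaleNr => /orP[] /positive_multiple; first by left.
by move=> eq_c; right; rewrite -[c]opprK eq_c.
Qed.

Lemma root_proportional (a b : lattice) (c d : int) : a \in root_vectors -> b \in root_vectors ->
  c *: a = d *: b -> (c != 0) || (d != 0) -> a = b \/ a = - b.
Proof.
move=> a_root b_root; move: b b_root a a_root.
apply: (weyl_ind (Q := fun b => forall a : lattice, a \in root_vectors ->
  c *: a = d *: b -> (c != 0) || (d != 0) -> a = b \/ a = - b))
  => [i a|b i _ IHb a] a_root eq_ab cd.
  have cN0 : c != 0.
    apply: contraTneq cd => c0; move: eq_ab; rewrite c0 scale0r eqxx /=.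
    move=> /rowP/(_ i); rewrite mxE rowZE simple_diag mulr1 => <-.
    by rewrite eqxx.
  have eq_a : a = a 0 i *: simple i.
    apply/rowP => j; rewrite rowZE simpleE; have [->|neq] := eqVneq j i.
      by rewrite mulr1.
    have /rowP/(_ j) := eq_ab; rewrite mulr0 !rowZE simpleE (negPf neq) mulr0.
    by move/eqP; rewrite mulf_eq0 (negPf cN0) => /eqP.
  move: a_root; rewrite eq_a => /root_multiple[] ->; first by left; rewrite scale1r.
  by right; rewrite scaleN1r.
have := IHb (refl i a); rewrite root_reflectionE a_root => /(_ isT).
rewrite -reflectionZ eq_ab reflectionZ (reflectionK (@cartan_diag X)).
case/(_ erefl cd) => eq_a; [left|right]; apply: (can_inj (reflectionK (@cartan_diag X) i)).
  by rewrite (reflectionK (@cartan_diag X)).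
by rewrite reflectionN (reflectionK (@cartan_diag X)).
Qed.

Lemma root_add_neq (a b : lattice) : a \in root_vectors -> b \in root_vectors ->
  a + b \in root_vectors -> a != b /\ a != - b.
Proof.
move=> a_root b_root ab_root; split; apply: contraTneq ab_root => eq_a; last first.
  by rewrite eq_a addNr; apply/negP => /root_neq0; rewrite eqxx.
have b0 := root_neq0 b_root.
apply/negP; rewrite eq_a -mulr2n -scaler_nat => /root_proportional.
case/(_ b 1 2 b_root); rewrite ?scale1r //= => /eqP; rewrite scaler_nat mulr2n.
  by rewrite -subr_eq0 addrK (negPf b0).
have /rV0Pn[j bj] := b0.
rewrite -addr_eq0 -mulr2n -mulrSr => /eqP/rowP/(_ j)/eqP.
by rewrite mulmxnE mxE mulrn_eq0 (negPf bj).
Qed.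

(** An integer minor stays nonzero in characteristic 0, which is how [root_row_free] obtains the
    linear independence required by the string relations of a Chevalley basis. *)
Lemma root_minor (a b : lattice) : a \in root_vectors -> b \in root_vectors -> a != b -> a != - b ->
  exists i j, a 0 i * b 0 j != a 0 j * b 0 i.
Proof.
move=> a_root b_root neq neqN.
have [/existsP[i /existsP[j ne]]|] :=
  boolP [exists i, exists j, a 0 i * b 0 j != a 0 j * b 0 i]; first by exists i, j.
move=> /existsPn H; have /rV0Pn[j bj] := root_neq0 b_root.
have eq_ab : b 0 j *: a = a 0 j *: b.
  apply/rowP => i; rewrite !rowZE; apply/eqP.
  by have /existsPn/(_ j) := H i; rewrite negbK mulrC.
have [|/eqP|/eqP] := root_proportional a_root b_root eq_ab; first by rewrite bj.
  by rewrite (negPf neq).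
by rewrite (negPf neqN).
Qed.

(** A simple root has a coordinate equal to 1, and reflections preserve p Q. *)
Lemma root_not_multiple (p : nat) (x y : lattice) : prime p -> x \in root_vectors -> x <> y *+ p.
Proof.
move=> p_pr x_root; move: x x_root y.
apply: (weyl_ind (Q := fun x => forall y : lattice, x <> y *+ p)) => [i y|x i _ IHx y].
  move/rowP/(_ i); rewrite simple_diag mulmxnE.
  move/(congr1 (fun z => `|z|%N)); rewrite -mulr_natr abszM natz absz_nat mulnC.
  move=> /esym/eqP; rewrite muln_eq1 => /andP[/eqP p1 _].
  by rewrite p1 in p_pr.
move=> eq_x; apply: (IHx (refl i y)).
by rewrite -scaler_nat -reflectionZ scaler_nat -eq_x (reflectionK (@cartan_diag X)).
Qed.

(** The adjugate turns the pairings into [cartan_det X] times the coordinates, and this factor is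
    invertible in [F]. *)
Lemma pairing_mod (F : fieldType) (p : nat) (x : lattice) : p \in [pchar F] ->
  (cartan_det X)%:R != 0 :> F ->
  (forall i, (pr x i)%:~R = 0 :> F) -> exists y : lattice, x = y *+ p.
Proof.
move=> pF d0 x0.
have xj j : (x 0 j)%:~R = 0 :> F.
  apply/eqP; rewrite -(mulrI_eq0 _ (mulfI d0)).
  rewrite -[(cartan_det X)%:R]/((cartan_det X)%:Z%:~R) -intrM.
  rewrite -(pairing_adj (cartan_mul_adj X)) rmorph_sum big1 //= => i _.
  by rewrite intrM x0 mul0r.
exists (\row_j (x 0%R j %/ p)%Z); apply/rowP => j.
rewrite mulmxnE mxE -mulr_natr natz divzK //.
by rewrite (dvdz_pcharf pF) xj.
Qed.

Lemma descent x : positive x -> (forall i, x <> simple i) ->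
  exists2 i, positive (x - simple i) &
    x + simple i \notin root_vectors \/
    X = G2 /\ x + x + simple i \notin root_vectors.
Proof.
case/mapP => s s_pos ->; have [sz_s _] := positive_rootP s_pos.
have /and4P[_ _ /allP/(_ s s_pos) + _] := root_list_checked X.
case/orP => [/hasP_iota[i /eqP ->] /(_ i)|/hasP_iota[i /andP[si_pos H]] _].
  by rewrite rowl_simple.
exists i.
  by rewrite -positive_mem ?size_mkseq // rowl_add rowl_opp rowl_simple in si_pos.
rewrite -mem_roots ?size_mkseq // -mem_roots ?size_mkseq // in H.
rewrite !rowl_add rowl_simple in H.
by case/orP: H => [|/andP[/is_G2]]; [left|right].
Qed.

(* For a derivation D with D H = 0, applying D to [V_a, V_x] = 0 shows that V_b
   does not occur in D V_a. *)
Definition detects (a b x : lattice) :=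
  [/\ x \in root_vectors, b + x \in root_vectors & x - b \notin root_vectors] /\
  [/\ a + x != 0, a + x \notin root_vectors & x + (b - a) \notin root_vectors].

Lemma gcdl_dvd p s (y : lattice) : size s = n -> rowl X s = y *+ p -> (p %| gcdl s)%N.
Proof.
move=> sz_s /rowP eq_s.
have: all (fun z => p %| `|z|)%N s.
  apply/(all_nthP 0) => i; rewrite sz_s => lt_in.
  have := eq_s (Ordinal lt_in); rewrite mxE mulmxnE /= => ->.
  by rewrite -mulr_natr natz abszM dvdn_mull.
by elim: (s) => //= z t IHt /andP[pz /IHt pt]; rewrite dvdn_gcd pz.
Qed.

Lemma detect_simple (p : nat) (a : lattice) (i : 'I_n) (y : lattice) :
  prime p -> ~~ exceptional_case X p -> a \in root_vectors -> a != simple i ->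
  simple i - a = y *+ p -> exists x, detects a (simple i) x.
Proof.
move=> p_pr pX /mapP[s s_in ->] neq eq_y.
have sz_s := size_root s_in.
have /and4P[_ _ _ /allP_iota/(_ i)/allP/(_ s s_in)] := root_list_checked X.
have [eq_s|_] := eqVneq s (simplel X i); first by rewrite eq_s rowl_simple eqxx in neq.
have p_dvd : (p %| gcdl (addl X (simplel X i) (oppl X s)))%N.
  apply: (gcdl_dvd (y := y)); first by rewrite size_mkseq.
  by rewrite rowl_add rowl_opp rowl_simple.
rewrite /=; set g := gcdl _ in p_dvd *.
have [g1|_] := eqVneq g 1%N.
  by move: p_dvd; rewrite g1 dvdn1 => /eqP p1; rewrite p1 in p_pr.
have isG2N : (if X is G2 then g == 2%N else false) = false.
  apply: contraNF pX => H; have [eX /eqP g2] : X = G2 /\ g == 2%N.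
    by move: H; clear; case: (X).
  by move: p_dvd; rewrite eX g2 dvdn_prime2.
rewrite isG2N {g p_dvd isG2N}.
case/hasP => t t_in; have sz_t := size_root t_in.
case: ifP => // bt; case: ifP => // tb; rewrite inE.
case: eqP => //= st0; case: ifP => //= st tbs.
exists (rowl X t); rewrite /detects -rowl_simple -!rowl_opp -!rowl_add.
rewrite !mem_roots ?size_mkseq // t_in bt tb st; split=> //; split=> //.
apply/eqP; rewrite -rowl_zero => /rowl_inj; rewrite size_mkseq size_nseq => H.
by case: st0; apply: H.
Qed.

(** All conditions in [detects] are invariant under simultaneous reflection of [a], [b] and [x], so
    [b] may be taken simple. *)
Lemma detect (p : nat) (a b : lattice) (y : lattice) :
  prime p -> ~~ exceptional_case X p -> a \in root_vectors -> b \in root_vectors -> a != b ->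
  b - a = y *+ p -> exists x, detects a b x.
Proof.
move=> p_pr pX a_root b_root; move: b b_root a a_root y.
apply: (weyl_ind (Q := fun b => forall a : lattice, a \in root_vectors -> forall y : lattice,
  a != b -> b - a = y *+ p -> exists x, detects a b x)) => [i a|b i b_root IHb a] a_root y neq eq_y.
  exact: detect_simple eq_y.
have rK := reflectionK (@cartan_diag X) i.
have ra_root : refl i a \in root_vectors by rewrite root_reflectionE.
have [||x [[x1 x2 x3] [x4 x5 x6]]] := IHb _ ra_root (refl i y).
- by apply: contra_neq neq => <-; rewrite rK.
- by rewrite -scaler_nat -reflectionZ scaler_nat -eq_y reflectionD reflectionN rK.
exists (refl i x); rewrite /detects -!reflectionN -!reflectionD -[a]rK.
rewrite -!reflectionN -!reflectionD !root_reflectionE; split=> //; split=> //.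
  by rewrite -(inj_eq (can_inj rK)) rK reflection0.
by rewrite reflectionN.
Qed.
End RootLattice2.

Lemma single_term (I : eqType) (V : nmodType) (r : seq I) (i0 : I) (f : I -> V) :
  uniq r -> i0 \in r -> (forall i, i \in r -> i != i0 -> f i = 0) ->
  \sum_(i <- r) f i = f i0.
Proof.
move=> Ur i0r f0; rewrite (bigD1_seq i0) //= big_seq_cond big1 ?addr0 // => i.
by case/andP; apply: f0.
Qed.

(** * Lie algebras with a Chevalley basis *)

Section LinearMaps.
Variables (K : fieldType) (U W : lmodType K) (f : U -> W) (lf : linear f).
Let f' : {linear U -> W} := HB.pack f (GRing.isLinear.Build K U W *:%R f lf).

Lemma linP_sum I (r : seq I) (P : pred I) (a : I -> K) x :
  f (\sum_(i <- r | P i) a i *: x i) = \sum_(i <- r | P i) a i *: f (x i).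
Proof.
rewrite -[f]/(f' : U -> W) linear_sum.
by apply: eq_bigr => i _; rewrite linearZZ.
Qed.
Lemma linPD x y : f (x + y) = f x + f y. Proof. exact: (linearD f'). Qed.
Lemma linPN x : f (- x) = - f x. Proof. exact: (linearN f'). Qed.
Lemma linPZ a x : f (a *: x) = a *: f x. Proof. exact: (linearZZ f'). Qed.
Lemma linP0 : f 0 = 0. Proof. exact: (linear0 f'). Qed.
End LinearMaps.

Section ScalarMaps.
Variables (K : fieldType) (U : lmodType K) (f : U -> K) (lf : scalar f).

Lemma scalP_sum I (r : seq I) (P : pred I) (a : I -> K) x :
  f (\sum_(i <- r | P i) a i *: x i) = \sum_(i <- r | P i) a i * f (x i).
Proof. exact: (@linP_sum _ _ K^o f lf). Qed.
Lemma scalPD x y : f (x + y) = f x + f y. Proof. exact: (@linPD _ _ K^o f lf). Qed.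
Lemma scalPN x : f (- x) = - f x. Proof. exact: (@linPN _ _ K^o f lf). Qed.
Lemma scalPZ a x : f (a *: x) = a * f x. Proof. exact: (@linPZ _ _ K^o f lf). Qed.
Lemma scalP0 : f 0 = 0. Proof. exact: (@linP0 _ _ K^o f lf). Qed.
End ScalarMaps.

Section LieBrackets.
Variables (K : fieldType) (V : lmodType K) (br : V -> V -> V).
Hypothesis lieV : is_lie_bracket br.

Lemma brDl x y z : br (x + y) z = br x z + br y z.
Proof. exact: (linPD (lie_linearl lieV z)). Qed.
Lemma brDr x y z : br x (y + z) = br x y + br x z.
Proof. exact: (linPD (lie_linearr lieV x)). Qed.
Lemma brZl a x y : br (a *: x) y = a *: br x y.
Proof. exact: (linPZ (lie_linearl lieV y)). Qed.
Lemma brZr a x y : br x (a *: y) = a *: br x y.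
Proof. exact: (linPZ (lie_linearr lieV x)). Qed.
Lemma brNl x y : br (- x) y = - br x y.
Proof. exact: (linPN (lie_linearl lieV y)). Qed.
Lemma brNr x y : br x (- y) = - br x y.
Proof. exact: (linPN (lie_linearr lieV x)). Qed.
Lemma br0l x : br 0 x = 0.
Proof. exact: (linP0 (lie_linearl lieV x)). Qed.
Lemma br0r x : br x 0 = 0.
Proof. exact: (linP0 (lie_linearr lieV x)). Qed.
Lemma br_suml I (r : seq I) (P : pred I) (a : I -> K) x y :
  br (\sum_(i <- r | P i) a i *: x i) y = \sum_(i <- r | P i) a i *: br (x i) y.
Proof. exact: (linP_sum (lie_linearl lieV y)). Qed.
Lemma br_sumr I (r : seq I) (P : pred I) (a : I -> K) x y :
  br y (\sum_(i <- r | P i) a i *: x i) = \sum_(i <- r | P i) a i *: br y (x i).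
Proof. exact: (linP_sum (lie_linearr lieV y)). Qed.

Lemma brC x y : br x y = - br y x.
Proof.
apply/eqP; rewrite -addr_eq0; apply/eqP.
have := lie_alternating lieV (x + y).
by rewrite brDl !brDr !(lie_alternating lieV) addr0 add0r.
Qed.

Lemma br_der x y z : br x (br y z) = br (br x y) z + br y (br x z).
Proof.
have := lie_jacobi lieV x y z.
rewrite (brC z (br x y)) (brC z x) brNr => /eqP; rewrite subr_eq0 subr_eq => /eqP ->.
by [].
Qed.

Lemma inner_is_derivation D : is_inner br D -> is_derivation br D.
Proof.
case=> x Dx; split=> [a u v|u v]; rewrite !Dx; first exact: lie_linearr.
exact: br_der.
Qed.

Lemma derivation_add_inner D x :
  is_derivation br D -> is_derivation br (fun u => D u + br x u).
Proof.
case=> linD derD; split=> [a u v|u v].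
  by rewrite linD (lie_linearr lieV) scalerDr addrACA.
by rewrite derD br_der brDl brDr addrACA.
Qed.

Lemma inner_sub D x : is_inner br (fun u => D u + br x u) -> is_inner br D.
Proof.
case=> y Dy; exists (y - x) => u; rewrite brDl brNl -Dy addrK.
by [].
Qed.
End LieBrackets.

Lemma uniq_root_vectors X : uniq (root_vectors X).
Proof.
have /and4P[_ /and4P[Upos _ _ _] _ _] := root_list_checked X.
have Rinj : {in positive_roots X &, injective (rowl X)}.
  by move=> s t /positive_rootP[ss _] /positive_rootP[st _]; apply: rowl_inj.
rewrite /root_vectors map_cat cat_uniq map_inj_in_uniq // Upos /= -map_comp.
apply/andP; split.
  apply/hasPn => _ /mapP[s s_pos ->]; apply/negP => /= neg.
  have x_pos : positive (rowl X s) by apply: map_f.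
  have [_ pos _] := positive_systemP X; have [x0 _] := pos _ x_pos.
  case/eqP: x0; apply/rowP => j; rewrite [RHS]mxE; apply/eqP; rewrite eq_le.
  rewrite (positive_ge0 x_pos) andbT; rewrite rowl_opp in neg.
  by have := positive_ge0 neg j; rewrite rowNE oppr_ge0.
rewrite map_inj_in_uniq // => s t s_pos t_pos /=.
by rewrite !rowl_opp => /oppr_inj; apply: Rinj.
Qed.

Section ChevalleyData.
Variables (X : exceptional_type) (F : fieldType) (L : lmodType F) (br : L -> L -> L).
Local Notation n := (dynkin_rank X).
Local Notation lattice := 'rV[int]_n.
Local Notation R := (root_vectors X).
Local Notation pr a i := ((pairing (cartan X) a i)%:~R : F).
Variables (V : lattice -> L) (H : 'I_n -> L).
Variables (cv : lattice -> L -> F) (ch : 'I_n -> L -> F).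

(* Only the values of V and cv on R matter. *)
Record chevalley_data : Prop := ChevalleyData {
  cv_scalar : forall a, scalar (cv a);
  ch_scalar : forall i, scalar (ch i);
  coordE : forall x, x = \sum_(a <- R) cv a x *: V a + \sum_i ch i x *: H i;
  cvV : forall a b, a \in R -> b \in R -> cv a (V b) = (a == b)%:R;
  cvH : forall a i, a \in R -> cv a (H i) = 0;
  chV : forall a i, a \in R -> ch i (V a) = 0;
  chH : forall i j, ch i (H j) = (i == j)%:R;
  brHH : forall i j, br (H i) (H j) = 0;
  brHV : forall i a, a \in R -> br (H i) (V a) = pr a i *: V a;
  brVopp : forall a b, a \in R -> b \in R -> cv b (br (V a) (V (- a))) = 0;
  brVsimple : forall i, br (V (simple i)) (V (- simple i)) = H i;
  brV0 : forall a b, a \in R -> b \in R -> a + b != 0 -> a + b \notin R ->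
    br (V a) (V b) = 0;
  brVV : forall a b, a \in R -> b \in R -> a + b \in R ->
    exists c, br (V a) (V b) = c *: V (a + b);
  brVstring : forall a b (s : nat), a \in R -> b \in R -> a + b \in R ->
    (forall j, (j <= s)%N -> b - a *+ j \in R) -> b - a *+ s.+1 \notin R ->
    br (V a) (V b) = s.+1%:R *: V (a + b) \/
    br (V a) (V b) = - (s.+1%:R *: V (a + b)) }.

Hypotheses (lieL : is_lie_bracket br) (dataL : chevalley_data).

Let UR : uniq R := uniq_root_vectors X.
Let cvs a := cv_scalar dataL a.
Let chs i := ch_scalar dataL i.

Lemma coord_eq x y : (forall a, a \in R -> cv a x = cv a y) ->
  (forall i, ch i x = ch i y) -> x = y.
Proof.
move=> eqv eqh; rewrite [x](coordE dataL) [y](coordE dataL); congr (_ + _).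
  by apply: eq_big_seq => a /eqv ->.
by apply: eq_bigr => i _; rewrite eqh.
Qed.

Lemma cv_br a b c : a \in R -> b \in R -> c \in R -> c != a + b ->
  cv c (br (V a) (V b)) = 0.
Proof.
move=> aR bR cR neq; have [ab0|ab0] := eqVneq (a + b) 0.
  have -> : b = - a by apply/eqP; rewrite -addr_eq0 addrC ab0.
  exact: brVopp.
have [abR|abR] := boolP (a + b \in R); last first.
  by rewrite (brV0 dataL) // (scalP0 (cvs c)).
have [k ->] := brVV dataL aR bR abR.
by rewrite (scalPZ (cvs c)) (cvV dataL) // (negPf neq) mulr0.
Qed.

Lemma cv_sumV (f : lattice -> F) a : a \in R ->
  cv a (\sum_(b <- R) f b *: V b) = f a.
Proof.
move=> aR; rewrite (scalP_sum (cvs a)) (single_term UR aR) => [|b bR neq].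
  by rewrite (cvV dataL) // eqxx mulr1.
by rewrite (cvV dataL) // eq_sym (negPf neq) mulr0.
Qed.

Lemma ch_sumV (f : lattice -> F) i : ch i (\sum_(b <- R) f b *: V b) = 0.
Proof.
rewrite (scalP_sum (chs i)) big_seq big1 // => b bR.
by rewrite (chV dataL) // mulr0.
Qed.

Lemma ch_sumH (f : 'I_n -> F) i : ch i (\sum_j f j *: H j) = f i.
Proof.
rewrite (scalP_sum (chs i)) (bigD1 i) //= (chH dataL) eqxx mulr1 big1 ?addr0 // => j neq.
by rewrite (chH dataL) eq_sym (negPf neq) mulr0.
Qed.

Lemma brH_expand i x :
  br (H i) x = \sum_(a <- R) (pr a i * cv a x) *: V a.
Proof.
rewrite {1}[x](coordE dataL) (brDr lieL) !(br_sumr lieL) [X in _ + X]big1 ?addr0 => [|j _].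
  by apply: eq_big_seq => a aR; rewrite (brHV dataL) // scalerA mulrC.
by rewrite (brHH dataL) scaler0.
Qed.

Lemma cv_brH a i x : a \in R -> cv a (br (H i) x) = pr a i * cv a x.
Proof. by move=> aR; rewrite brH_expand (cv_sumV (fun a => pr a i * cv a x)). Qed.

Lemma ch_brH j i x : ch j (br (H i) x) = 0.
Proof. by rewrite brH_expand (ch_sumV (fun a => pr a i * cv a x)). Qed.

Lemma brV_expand x a : a \in R -> br x (V a) =
  \sum_(b <- R) cv b x *: br (V b) (V a) + (\sum_i ch i x * pr a i) *: V a.
Proof.
move=> aR; rewrite {1}[x](coordE dataL) (brDl lieL) !(br_suml lieL); congr (_ + _).
by rewrite scaler_suml; apply: eq_bigr => i _; rewrite (brHV dataL) // scalerA.
Qed.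

(** A bracket with a root vector moves [V a] off its own line, so only the Cartan part of [x]
    contributes. *)
Lemma cv_brV_diag x a : a \in R ->
  cv a (br x (V a)) = \sum_i ch i x * pr a i.
Proof.
move=> aR; rewrite brV_expand // (scalPD (cvs a)) (scalPZ (cvs a)).
rewrite (cvV dataL) // eqxx mulr1 (scalP_sum (cvs a)) big_seq big1 ?add0r // => b bR.
rewrite cv_br ?mulr0 //; apply: contra_neq (root_neq0 bR).
by move/(congr1 (fun c => c - a)); rewrite addrK subrr => ->.
Qed.

Lemma cv_brV x a c : a \in R -> c \in R -> c != a ->
  cv c (br x (V a)) = if c - a \in R then cv (c - a) x * cv c (br (V (c - a)) (V a))
                      else 0.
Proof.
move=> aR cR neq; rewrite brV_expand // (scalPD (cvs c)) (scalPZ (cvs c)).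
rewrite (cvV dataL) // (negPf neq) mulr0 addr0 (scalP_sum (cvs c)).
have other b : b \in R -> b != c - a -> cv b x * cv c (br (V b) (V a)) = 0.
  move=> bR ne; rewrite cv_br ?mulr0 //; apply: contra_neq ne => ->.
  by rewrite addrK.
case: ifP => [caR|caR]; first by rewrite (single_term UR caR).
by rewrite big_seq big1 // => b bR; apply: other => //; apply: contraFneq caR => <-.
Qed.

End ChevalleyData.

(** * Inner derivations *)

Lemma adj_solve (X : exceptional_type) (F : fieldType) (f : 'I_(dynkin_rank X) -> F) :
  (cartan_det X)%:R != 0 :> F -> (forall i, \sum_j f j * (cartan X i j)%:~R = 0) ->
  forall j, f j = 0.
Proof.
move=> d0 f0 j; apply/eqP; rewrite -(mulrI_eq0 _ (mulfI d0)); apply/eqP.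
have e k : \sum_i (cartan_adj X j i)%:~R * (cartan X i k)%:~R
    = ((cartan_det X)%:R * (j == k)%:R : F).
  have /matrixP/(_ j k) := adj_mul_cartan X; rewrite [in LHS]mxE [in RHS]mxE.
  move/(congr1 (intr : int -> F)); rewrite rmorph_sum /= => e.
  transitivity (\sum_i (cartan_adj X j i * cartan X i k)%:~R : F).
    by apply: eq_bigr => i _; rewrite intrM.
  by rewrite e; case: eqP => _; rewrite ?mulr1 ?mulr0 // mulr0z.
transitivity (\sum_i (cartan_adj X j i)%:~R * \sum_k f k * (cartan X i k)%:~R); last first.
  by rewrite big1 // => i _; rewrite f0 mulr0.
under eq_bigr do rewrite mulr_sumr.
rewrite exchange_big /=.
under eq_bigr => k _ do under eq_bigr do rewrite mulrCA.
under eq_bigr => k _ do rewrite -mulr_sumr e.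
rewrite (bigD1 j) //= eqxx mulr1 big1 ?addr0 1?mulrC // => k neq.
by rewrite eq_sym (negPf neq) !mulr0.
Qed.

Section InnerDerivations.
Variables (X : exceptional_type) (F : fieldType) (L : lmodType F) (br : L -> L -> L).
Local Notation n := (dynkin_rank X).
Local Notation lattice := 'rV[int]_n.
Local Notation R := (root_vectors X).
Local Notation pr a i := ((pairing (cartan X) a i)%:~R : F).
Variables (V : lattice -> L) (H : 'I_n -> L).
Variables (cv : lattice -> L -> F) (ch : 'I_n -> L -> F).
Hypotheses (lieL : is_lie_bracket br) (dataL : chevalley_data br V H cv ch).

Let UR : uniq R := uniq_root_vectors X.
Let cvs a := cv_scalar dataL a.
Let chs i := ch_scalar dataL i.

Variables (p : nat) (pF : p \in [pchar F]) (pX : ~~ exceptional_case X p).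

Let p_prime : prime p := pcharf_prime pF.

Lemma cartan_det_neq0 : (cartan_det X)%:R != 0 :> F.
Proof.
rewrite -(dvdn_pcharf pF); move: pX; case: (X) => //= pX';
  rewrite ?dvdn1 ?dvdn_prime2 //; apply: contraTneq p_prime => -> //.
Qed.

Lemma root_pairing_neq0 a : a \in R -> exists i, pr a i != 0.
Proof.
move=> aR; apply/existsP; apply: contraT => /existsPn a0.
have [i|y] := pairing_mod pF cartan_det_neq0 (x := a).
  by apply/eqP; rewrite -[_ == _]negbK a0.
by move/(root_not_multiple p_prime aR).
Qed.

(** Applying [D] to [H_i, H_j] = 0 shows that the quotient of [cv g (D (H i))] by <g, a_i> is the
    same for all i with nonzero denominator. These quotients are the coefficients of [z]; such an i
    exists for every root, so the default 0 in [m] is never met. *)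
Lemma normalize_cartan D : is_derivation br D ->
  exists z, forall g i, g \in R -> cv g (D (H i) + br z (H i)) = 0.
Proof.
move=> [linD derD].
pose m g := if [pick i | pr g i != 0] is Some i then cv g (D (H i)) / pr g i else 0.
exists (\sum_(g <- R) m g *: V g) => g i gR.
rewrite (scalPD (cvs g)) (brC lieL) (scalPN (cvs g)).
rewrite (cv_brH lieL dataL) // (cv_sumV dataL) // /m.
case: pickP => [j gj0|g0]; last first.
  by have [j] := root_pairing_neq0 gR; rewrite g0.
apply/eqP; rewrite subr_eq0; apply/eqP.
have /(congr1 (cv g)) := derD (H i) (H j).
rewrite (brHH dataL) (linP0 linD) (scalP0 (cvs g)) (scalPD (cvs g)).
rewrite (brC lieL (D (H i))) (scalPN (cvs g)) !(cv_brH lieL dataL) // => /esym/eqP.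
rewrite addrC subr_eq0 => /eqP e; rewrite mulrA e [X in X / _]mulrC mulfK //.
Qed.

Section CartanStable.
Variables (D : L -> L) (derD : is_derivation br D).
Hypothesis DH : forall g i, g \in R -> cv g (D (H i)) = 0.

Let Dlin : linear D := derD.1.

Lemma D_cartan_expand i : D (H i) = \sum_j ch j (D (H i)) *: H j.
Proof.
rewrite {1}[D _](coordE dataL) big_seq big1 ?add0r // => a aR.
by rewrite DH ?scale0r.
Qed.

Let y i a := \sum_j ch j (D (H i)) * pr a j.

Lemma D_brHV i a : a \in R ->
  pr a i *: D (V a) = y i a *: V a + br (H i) (D (V a)).
Proof.
move=> aR; rewrite -(linPZ Dlin) -(brHV dataL) // derD.2 {1}D_cartan_expand.
congr (_ + _); rewrite (br_suml lieL) scaler_suml; apply: eq_bigr => j _.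
by rewrite (brHV dataL) // scalerA.
Qed.

(** [D (H i)] lies in the Cartan part. Comparing coefficients of [V (simple k)] in [D_brHV] shows
    that it acts by 0 on each simple root vector, and the Cartan matrix is invertible in [F]. *)
Lemma D_cartan_zero i : D (H i) = 0.
Proof.
apply: (coord_eq dataL) => [a aR|j]; first by rewrite (scalP0 (cvs a)) DH.
rewrite (scalP0 (chs j)); move: j; apply: adj_solve => [|k]; first exact: cartan_det_neq0.
have kR := simple_root k.
transitivity (y i (simple k)).
  by apply: eq_bigr => j _; rewrite pairing_simple.
have /(congr1 (cv (simple k))) := D_brHV i kR.
rewrite (scalPD (cvs _)) !(scalPZ (cvs _)) (cv_brH lieL dataL) //.
rewrite (cvV dataL) // eqxx mulr1 => /eqP.
by rewrite -[X in X == _]add0r (inj_eq (addIr _)) eq_sym => /eqP.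
Qed.

Lemma D_V_weight i a : a \in R -> pr a i *: D (V a) = br (H i) (D (V a)).
Proof.
move=> aR; rewrite D_brHV // /y big1 ?scale0r ?add0r // => j _.
by rewrite D_cartan_zero (scalP0 (chs j)) mul0r.
Qed.

(** The Cartan part has weight 0, while the weight of [D (V a)] is that of [a], which is nonzero in
    [F]. *)
Lemma ch_DV j a : a \in R -> ch j (D (V a)) = 0.
Proof.
move=> aR; have [i ai] := root_pairing_neq0 aR.
have /(congr1 (ch j)) := D_V_weight i aR.
rewrite (scalPZ (chs j)) (ch_brH lieL dataL) => /eqP.
by rewrite mulf_eq0 (negPf ai) => /eqP.
Qed.

Lemma cv_DV_off a b : a \in R -> b \in R -> a != b -> cv b (D (V a)) = 0.
Proof.
move=> aR bR neq; apply/eqP; apply: contraT => nz.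
(* A nonzero coefficient forces [a] and [b] to have the same weight, hence to be congruent modulo p
   Q. *)
have [i|z eqz] := pairing_mod pF cartan_det_neq0 (x := b - a).
  have /(congr1 (cv b)) := D_V_weight i aR.
  rewrite (scalPZ (cvs b)) (cv_brH lieL dataL) // => /(mulIf nz) e.
  by rewrite pairingD pairingN intrD mulrNz e subrr.
have [x [[xR bxR xbR] [ax0 axR xbaR]]] := detect p_prime pX aR bR neq eqz.
case/eqP: nz.
have /(congr1 (cv (b + x))) := derD.2 (V a) (V x).
rewrite (brV0 dataL) // (linP0 Dlin) (scalP0 (cvs _)) (scalPD (cvs _)).
(* [V (b + x)] could only arise here from the component of [D (V x)] along [b + x - a], which is not
   a root, or, when [b + x = a], from its Cartan part, which is 0. *)
have -> : cv (b + x) (br (V a) (D (V x))) = 0.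
  rewrite (brC lieL) (scalPN (cvs _)); have [->|ne] := eqVneq (b + x) a.
    rewrite (cv_brV_diag lieL dataL) // big1 ?oppr0 // => i _.
    by rewrite ch_DV ?mul0r.
  rewrite (cv_brV lieL dataL) //.
  by rewrite [b + x]addrC -addrA (negPf xbaR) oppr0.
rewrite addr0 (cv_brV lieL dataL) //; last by rewrite -subr_eq0 addrK root_neq0.
rewrite addrK bR => /esym/eqP; rewrite mulf_eq0 => /orP[/eqP //|].
(* As [x - b] is not a root, the structure constant is 1 up to sign, hence nonzero in every
   characteristic. *)
have := brVstring dataL (s := 0) bR xR bxR; rewrite mulr1n.
case=> // [[] // _|->|->]; rewrite ?mulr0n ?subr0 // scale1r ?(scalPN (cvs _));
  by rewrite (cvV dataL) // eqxx ?oppr_eq0 oner_eq0.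
Qed.

Hypothesis Dsimple : forall i, cv (simple i) (D (V (simple i))) = 0.

Let k a := cv a (D (V a)).

Lemma D_diag a : a \in R -> D (V a) = k a *: V a.
Proof.
move=> aR; apply: (coord_eq dataL) => [b bR|i]; last first.
  by rewrite ch_DV // (scalPZ (chs i)) (chV dataL) // mulr0.
rewrite (scalPZ (cvs b)) (cvV dataL) //; have [->|neq] := eqVneq b a.
  by rewrite mulr1.
by rewrite mulr0 cv_DV_off // eq_sym.
Qed.

(** The additivity needs a structure constant that does not vanish in [F]. The string condition
    makes it 1 up to sign, or possibly 2 in type G2, where p = 2 is excluded. *)
Lemma weight_add a b : a \in R -> b \in R -> a + b \in R ->
  b - a \notin R \/ X = G2 /\ b - a *+ 2 \notin R -> k (a + b) = k a + k b.
Proof.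
move=> aR bR abR no_string.
suff [c c0 eq_c] : exists2 c, c != 0 & br (V a) (V b) = c *: V (a + b).
  have := derD.2 (V a) (V b).
  rewrite eq_c (linPZ Dlin) !D_diag // (brZl lieL) (brZr lieL) eq_c !scalerA -scalerDl.
  move/(congr1 (cv (a + b))); rewrite !(scalPZ (cvs _)) (cvV dataL) // eqxx !mulr1.
  by rewrite -mulrDl mulrC => /(mulIf c0).
have [s [s0 in_s out_s]] : exists s : nat,
    [/\ s.+1%:R != 0 :> F, forall j, (j <= s)%N -> b - a *+ j \in R
      & b - a *+ s.+1 \notin R].
  have [baR|baR] := boolP (b - a \in R); last first.
    exists 0%N; split; rewrite ?oner_neq0 ?mulr1n // => -[] // _.
    by rewrite mulr0n subr0.
  exists 1%N; case: no_string => [|[eX out]]; first by rewrite baR.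
  split=> // [|[|[]] // _]; rewrite ?mulr0n ?subr0 ?mulr1n //.
  rewrite -(dvdn_pcharf pF) dvdn_prime2 //.
  by move: pX; rewrite eX.
have [->|->] := brVstring dataL aR bR abR in_s out_s.
  by exists s.+1%:R.
by exists (- s.+1%:R); rewrite ?oppr_eq0 ?scaleNr.
Qed.

(** The root vectors for [simple i] and its negative have bracket [H i], which [D] kills, so their
    weights are opposite. *)
Lemma weight_simpleN i : k (- simple i) = 0.
Proof.
have iR := simple_root i; have iNR : - simple i \in R by rewrite rootsN.
have := derD.2 (V (simple i)) (V (- simple i)).
rewrite (brVsimple dataL) D_cartan_zero !D_diag // /(k (simple i)) Dsimple.
rewrite scale0r (br0l lieL) add0r (brZr lieL) (brVsimple dataL).
move/(congr1 (ch i)); rewrite (scalP0 (chs i)) (scalPZ (chs i)) (chH dataL).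
by rewrite eqxx mulr1.
Qed.

Lemma weight_positive a : positive a -> k a = 0 /\ k (- a) = 0.
Proof.
pose height (y : lattice) : int := \sum_j y 0 j.
have [m] := ubnP `|height a|%N; elim: m a => // m IHm a; rewrite ltnS => le_am a_pos.
have [/existsP[i /eqP ->]|/existsPn H0] := boolP [exists i, a == simple i].
  by rewrite weight_simpleN; split=> //; apply: Dsimple.
have [|i b_pos no_string] := descent a_pos; first by move=> i e; have := H0 i; rewrite e eqxx.
have aR : a \in R by rewrite rootsE a_pos.
have bR : a - simple i \in R by rewrite rootsE b_pos.
have iR := simple_root i.
have [|kb kNb] := IHm (a - simple i) _ b_pos.
  have : 0 <= height (a - simple i) by apply: sumr_ge0 => j _; apply: positive_ge0.
  have : height a = height (a - simple i) + 1.
    have <- : height (simple i) = 1.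
      rewrite /height (bigD1 i) //= simple_diag big1 ?addr0 // => j neq.
      by rewrite simpleE (negPf neq).
    rewrite /height -big_split /=; apply: eq_bigr => j _.
    by rewrite rowDE rowNE subrK.
  case: (height (a - simple i)) => // h e _; apply: leq_trans le_am.
  by rewrite e addrC -intS absz_nat.
split.
  (* Additivity is used downwards, for the sum of [a] and [- simple i], because [descent] controls
     the string of [a] through [- simple i]. *)
  have -> : k a = k (a - simple i); last by [].
  rewrite weight_add ?rootsN ?weight_simpleN ?addr0 //.
  rewrite -!opprD !rootsN addrC [simple i + _]addrC mulr2n.
  by case: no_string; [left|right].
have -> : k (- a) = k (- (a - simple i)); last by [].
rewrite opprB addrC weight_add ?rootsN //; first 1 last.
- by rewrite addrC -opprB rootsN.
- rewrite mulNrn !opprK addrC [simple i + _]addrC mulr2n.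
  by case: no_string; [left|right].
by rewrite [k (simple i)]Dsimple addr0.
Qed.

Lemma D_zero x : D x = 0.
Proof.
rewrite {1}[x](coordE dataL) (linPD Dlin) !(linP_sum Dlin) big_seq !big1 ?addr0 //.
  by move=> i _; rewrite D_cartan_zero scaler0.
move=> a aR; rewrite D_diag //.
suff -> : k a = 0 by rewrite scale0r scaler0.
by move: aR; rewrite rootsE => /orP[] /weight_positive[]; rewrite ?opprK.
Qed.

End CartanStable.

Lemma cartan_solve (c : 'I_n -> F) :
  exists f : 'I_n -> F, forall i, \sum_j f j * (cartan X i j)%:~R = c i.
Proof.
exists (fun j => (\sum_l (cartan_adj X j l)%:~R * c l) / (cartan_det X)%:R) => i.
have e l : \sum_j (cartan X i j)%:~R * (cartan_adj X j l)%:~R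
    = ((cartan_det X)%:R * (i == l)%:R : F).
  have /matrixP/(_ i l) := cartan_mul_adj X; rewrite [in LHS]mxE [in RHS]mxE.
  move/(congr1 (intr : int -> F)); rewrite rmorph_sum /= => e.
  transitivity (\sum_j (cartan X i j * cartan_adj X j l)%:~R : F).
    by apply: eq_bigr => j _; rewrite intrM.
  by rewrite e; case: eqP => _; rewrite ?mulr1 ?mulr0 // mulr0z.
transitivity ((\sum_l (\sum_j (cartan X i j)%:~R * (cartan_adj X j l)%:~R) * c l)
              / (cartan_det X)%:R).
  rewrite mulr_suml; under [RHS]eq_bigr do rewrite !mulr_suml.
  rewrite exchange_big; apply: eq_bigr => j _; rewrite -mulrA mulr_suml.
  by apply: eq_bigr => l _; rewrite [_^-1 * _]mulrC mulrA [_ * (cartan X i j)%:~R]mulrC mulrA.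
under eq_bigr do rewrite e.
rewrite (bigD1 i) //= eqxx mulr1 big1 ?addr0 => [|l neq].
  by rewrite mulrAC mulfV ?mul1r // cartan_det_neq0.
by rewrite eq_sym (negPf neq) mulr0 mul0r.
Qed.

Theorem derivation_inner D : is_derivation br D -> is_inner br D.
Proof.
move=> derD; have [z Dz] := normalize_cartan derD.
apply: (inner_sub lieL (x := z)).
pose D1 u := D u + br z u.
have derD1 : is_derivation br D1 := derivation_add_inner lieL z derD.
(* The bracket with the combination of the [H j] by [f] acts on [V (simple i)] by the left-hand side
   of this system, which is solved so as to cancel the diagonal coefficients of [D1] at the simple
   roots. *)
have [f f_eq] := cartan_solve (fun i => - cv (simple i) (D1 (V (simple i)))).
apply: (inner_sub lieL (x := \sum_j f j *: H j)).
exists 0 => u; rewrite (br0l lieL).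
apply: (D_zero (D := fun u => D1 u + br (\sum_j f j *: H j) u)) => [|g i gR|i].
- exact: derivation_add_inner.
- rewrite (scalPD (cvs g)) Dz // add0r (br_suml lieL) big1 ?(scalP0 (cvs g)) // => j _.
  by rewrite (brHH dataL) scaler0.
rewrite (scalPD (cvs _)) (cv_brV_diag lieL dataL) ?simple_root //.
under eq_bigr do rewrite (ch_sumH dataL) pairing_simple.
by rewrite f_eq addrN.
Qed.
End InnerDerivations.

(** * Outer derivations *)

Section OuterDerivations.
Variables (X : exceptional_type) (F : fieldType) (L : lmodType F) (br : L -> L -> L).
Local Notation n := (dynkin_rank X).
Local Notation lattice := 'rV[int]_n.
Local Notation R := (root_vectors X).
Local Notation pr a i := ((pairing (cartan X) a i)%:~R : F).
Variables (V : lattice -> L) (H : 'I_n -> L).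
Variables (cv : lattice -> L -> F) (ch : 'I_n -> L -> F).
Hypotheses (lieL : is_lie_bracket br) (dataL : chevalley_data br V H cv ch).

Let UR : uniq R := uniq_root_vectors X.
Let cvs a := cv_scalar dataL a.
Let chs i := ch_scalar dataL i.

Lemma linear_eq0 (f : L -> L) : linear f -> (forall a, a \in R -> f (V a) = 0) ->
  (forall i, f (H i) = 0) -> forall x, f x = 0.
Proof.
move=> linf fV fH x; rewrite [x](coordE dataL) (linPD linf) !(linP_sum linf).
rewrite big_seq !big1 ?addr0 // => [i|a] *; first by rewrite fH scaler0.
by rewrite fV // scaler0.
Qed.

(** The defect in the Leibniz rule is bilinear and skew-symmetric, so it suffices that it vanish on
    pairs of basis vectors, with one order for the mixed pairs. *)
Lemma derivation_on_basis D : linear D ->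
  (forall i j, br (D (H i)) (H j) + br (H i) (D (H j)) = 0) ->
  (forall i a, a \in R ->
     D (br (H i) (V a)) = br (D (H i)) (V a) + br (H i) (D (V a))) ->
  (forall a b, a \in R -> b \in R ->
     D (br (V a) (V b)) = br (D (V a)) (V b) + br (V a) (D (V b))) ->
  is_derivation br D.
Proof.
move=> linD DHH DHV DVV; split=> // x y.
pose defect x y := D (br x y) - (br (D x) y + br x (D y)).
have defectC u w : defect u w = - defect w u.
  rewrite /defect (brC lieL u w) (brC lieL (D u) w) (brC lieL u (D w)) (linPN linD).
  by rewrite !opprD !opprK [br w (D u) + _]addrC.
have lin_defect w : linear (defect^~ w).
  move=> c u u'; rewrite /defect (lie_linearl lieL) !linD !(lie_linearl lieL).
  by rewrite addrACA -scalerDr opprD addrACA -scalerN -scalerDr.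
suff : defect x y = 0 by move/eqP; rewrite subr_eq0 => /eqP.
have HH i j : defect (H i) (H j) = 0.
  by rewrite /defect DHH (brHH dataL) (linP0 linD) subrr.
have HV i a : a \in R -> defect (H i) (V a) = 0.
  by move=> aR; rewrite /defect DHV // subrr.
have zero w : (forall a, a \in R -> defect (V a) w = 0) ->
    (forall i, defect (H i) w = 0) -> forall u, defect u w = 0.
  exact: (linear_eq0 (lin_defect w)).
have zeroV a : a \in R -> forall u, defect u (V a) = 0.
  move=> aR; apply: zero => [b bR|i]; last exact: HV.
  by rewrite /defect DVV // subrr.
have zeroH i : forall u, defect u (H i) = 0.
  apply: zero => [a aR|j]; last exact: HH.
  by rewrite defectC HV ?oppr0.
rewrite defectC (zero x) ?oppr0 // => [a aR|i]; first by rewrite defectC zeroV ?oppr0.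
by rewrite defectC zeroH oppr0.
Qed.

Section ShiftMap.
Variables (w : lattice -> F) (g : lattice).

(** Homogeneous of degree [g] and zero on the Cartan part. Where [w a = 0], the vector [a + g] need
    not be a root. The degree is 0 for the gradings and [2 a_1] in type G2. *)
Definition shift_map (x : L) : L := \sum_(a <- R) (w a * cv a x) *: V (a + g).

Lemma shift_map_linear : linear shift_map.
Proof.
move=> c x y; rewrite /shift_map scaler_sumr -big_split; apply: eq_bigr => a _ /=.
by rewrite (scalPD (cvs a)) (scalPZ (cvs a)) mulrDr scalerDl mulrCA scalerA.
Qed.

Lemma shift_mapV a : a \in R -> shift_map (V a) = w a *: V (a + g).
Proof.
move=> aR; rewrite /shift_map (single_term UR aR) => [|b bR neq].
  by rewrite (cvV dataL) // eqxx mulr1.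
by rewrite (cvV dataL) // (negPf neq) mulr0 scale0r.
Qed.

Lemma shift_map0 x : (forall a, a \in R -> cv a x = 0) -> shift_map x = 0.
Proof.
by move=> x0; rewrite /shift_map big_seq big1 // => a aR; rewrite x0 ?mulr0 ?scale0r.
Qed.

Lemma shift_mapH i : shift_map (H i) = 0.
Proof. by apply: shift_map0 => a aR; rewrite (cvH dataL). Qed.

Lemma shift_map_derivation :
  (forall a i, a \in R -> w a != 0 -> a + g \in R /\ pr (a + g) i = pr a i) ->
  (forall a b, a \in R -> b \in R -> shift_map (br (V a) (V b)) =
     w a *: br (V (a + g)) (V b) + w b *: br (V a) (V (b + g))) ->
  is_derivation br shift_map.
Proof.
move=> wP DVV; apply: derivation_on_basis => [|i j|i a aR|a b aR bR].
- exact: shift_map_linear.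
- by rewrite !shift_mapH (br0l lieL) (br0r lieL) addr0.
- rewrite shift_mapH (br0l lieL) add0r (brHV dataL) //.
  rewrite (linPZ shift_map_linear) shift_mapV // (brZr lieL).
  have [->|wa] := eqVneq (w a) 0; first by rewrite !scale0r scaler0.
  have [agR eq_pr] := wP a i aR wa.
  by rewrite (brHV dataL) // eq_pr !scalerA mulrC.
by rewrite DVV // !shift_mapV // (brZl lieL) (brZr lieL).
Qed.
End ShiftMap.

(* The grading by the coefficient of a simple root is not induced by the Cartan
   part, as the Cartan matrix is singular. *)
Lemma degree_derivation (i0 j0 : 'I_n) : (cartan_det X)%:R = 0 :> F ->
  (cartan_adj X i0 j0)%:~R != 0 :> F ->
  exists2 D, is_derivation br D & ~ is_inner br D.
Proof.
move=> det0 adj_neq0; pose w (a : lattice) : F := (a 0 j0)%:~R.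
exists (shift_map w 0).
  apply: shift_map_derivation => [a i aR _|a b aR bR]; first by rewrite addr0.
  rewrite !addr0 -scalerDl.
  have -> : w a + w b = w (a + b) by rewrite /w rowDE intrD.
  have [ab0|ab0] := eqVneq (a + b) 0.
    rewrite ab0 /w mxE scale0r; apply: shift_map0 => c cR.
    have -> : b = - a by apply/eqP; rewrite -addr_eq0 addrC ab0.
    exact: (brVopp dataL aR cR).
  have [abR|abR] := boolP (a + b \in R); last first.
    by rewrite (brV0 dataL) // (linP0 (shift_map_linear _ _)) scaler0.
  have [c ->] := brVV dataL aR bR abR.
  by rewrite (linPZ (shift_map_linear _ _)) shift_mapV // addr0 !scalerA mulrC.
case=> z Dz; case/eqP: adj_neq0.
(* If the map were ad z, the Cartan part of [z] would solve this system. Row [i0] of the adjugate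
   then kills the left-hand side, since its product with the Cartan matrix is a multiple of the
   determinant, and leaves the nonzero entry at ([i0], [j0]) on the right. *)
have e i : \sum_j ch j z * (cartan X i j)%:~R = (i == j0)%:R.
  have := cv_brV_diag lieL dataL z (simple_root i).
  rewrite -Dz shift_mapV ?simple_root // addr0 (scalPZ (cvs _)) (cvV dataL) ?simple_root //.
  rewrite eqxx mulr1 /w simpleE eq_sym => e.
  transitivity (\sum_j ch j z * pr (simple i) j).
    by apply: eq_bigr => j _; rewrite pairing_simple.
  by rewrite -e; case: eqP.
transitivity (\sum_i (cartan_adj X i0 i)%:~R * \sum_j ch j z * (cartan X i j)%:~R).
  rewrite (bigD1 j0) //= e eqxx mulr1 big1 ?addr0 // => i neq.
  by rewrite e (negPf neq) mulr0.
under eq_bigr do rewrite mulr_sumr.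
rewrite exchange_big big1 //= => j _.
under eq_bigr do rewrite mulrCA -intrM.
rewrite -mulr_sumr -rmorph_sum /=.
have /matrixP/(_ i0 j) := adj_mul_cartan X; rewrite [in LHS]mxE [in RHS]mxE => ->.
by case: eqP => _; rewrite ?mulr0n ?mulr1n ?mulr0z ?mulr0 // -[_%:~R]/((cartan_det X)%:R) det0 mulr0.
Qed.
End OuterDerivations.

(** * Type G2 in characteristic 2 *)

Section G2Lists.
Local Notation Rl := (root_list G2).
Local Notation "s +l t" := (addl G2 s t) (at level 50, left associativity).
Local Notation "-l s" := (oppl G2 s) (at level 35, right associativity).

Definition stringl (s t : seq int) (j : nat) := iter j (fun u => u +l -l s) t.
(** [find] would return 6 if the string had not ended within the range; [string_end_lt] excludes
    this. *)
Definition string_end (s t : seq int) : nat :=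
  find (fun j => stringl s t j \notin Rl) (iota 0 6).
(* The structure constant s + 1 modulo 2; the string ends at s + 1. *)
Definition parity (s t : seq int) : bool :=
  (s +l t \in Rl) && odd (string_end s t).
Definition g2_shift : seq int := [:: 2; 0].
(** All roots [a] with [a + 2 a_1] a root, except [- a_1]. With [- a_1] included, the Leibniz rule
    would fail against [V_(a_2)]: the constant of [a_1] and [a_2] is odd, that of [- a_1] and
    [2 a_1 + a_2] is even. *)
Definition g2_support : seq (seq int) :=
  [:: [:: 0; 1]; [:: 1; 1]; [:: -2; -1]; [:: -3; -1]].
(** The value of [t] on [V_s, V_(-s)] modulo 2, expanded by the Jacobi identity into two double
    brackets. This detour is due to [chevalley_data], which specifies the Cartan part of that
    bracket only for simple [s]. *)
Definition coroot_parity (s t : seq int) : bool :=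
  (parity (-l s) t && parity s (t +l -l s)) (+)
  (parity s t && parity (-l s) (s +l t)).
Definition away (s t : seq int) : bool := (t != s) && (t != -l s).

Lemma string_end_lt : all (fun s => all (fun t => string_end s t < 6)%N Rl) Rl.
Proof. by vm_compute. Qed.

Lemma g2_shift_support : all (fun s => s +l g2_shift \in Rl) g2_support.
Proof. by vm_compute. Qed.

(** If [s + t = 0], the shifted brackets have degree [2 a_1], which is not a root, and vanish. If
    [s + t + 2 a_1 = 0], they lie in the Cartan part and have to cancel, so both terms must be
    present or both absent. Otherwise only structure constants modulo 2 are involved. *)
Lemma g2_shift_leibniz : all (fun s => all (fun t =>
  if s +l t == zerol G2 then true else
  if (s +l t) +l g2_shift == zerol G2 then (s \in g2_support) == (t \in g2_support) else
  ~~ ((parity s t && (s +l t \in g2_support)) (+)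
      ((s \in g2_support) && parity (s +l g2_shift) t) (+)
      ((t \in g2_support) && parity s (t +l g2_shift)))) Rl) Rl.
Proof. by vm_compute. Qed.

(** The test vectors generate the root lattice. The alternative to the second simple root is there
    because [coroot_parity] is meaningful only away from the two roots compared and their
    negatives. *)
Lemma g2_coroot_shift : all (fun s =>
  let good t := [&& away s t, away (s +l g2_shift) t &
                    coroot_parity s t == coroot_parity (s +l g2_shift) t] in
  good [:: 1; 0] && (good [:: 0; 1] || good [:: 1; 1])) g2_support.
Proof. by vm_compute. Qed.
End G2Lists.

Section G2Characteristic2.
Variables (F : fieldType) (L : lmodType F) (br : L -> L -> L).
Local Notation lattice := 'rV[int]_(dynkin_rank G2).
Local Notation R := (root_vectors G2).
Local Notation Rl := (root_list G2).
Local Notation pr a i := ((pairing (cartan G2) a i)%:~R : F).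
Variables (V : lattice -> L) (H : 'I_(dynkin_rank G2) -> L).
Variables (cv : lattice -> L -> F) (ch : 'I_(dynkin_rank G2) -> L -> F).
Hypotheses (lieL : is_lie_bracket br) (dataL : chevalley_data br V H cv ch).
Hypothesis char2 : 2%N \in [pchar F].

Let cvs a := cv_scalar dataL a.
Let chs i := ch_scalar dataL i.
Local Notation "s +l t" := (addl G2 s t) (at level 50, left associativity).
Local Notation "-l s" := (oppl G2 s) (at level 35, right associativity).
Local Notation rl := (rowl G2).
Let W s := V (rl s).

Let rR s : s \in Rl -> rl s \in R.
Proof. exact: map_f. Qed.

Let natb (m : nat) : m%:R = (odd m)%:R :> F.
Proof.
by rewrite -{1}(odd_double_half m) -muln2 natrD natrM (pcharf0 char2) mulr0 addr0.
Qed.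

Let oppF (x : F) : - x = x. Proof. exact: (oppr_pchar2 char2). Qed.
Let oppL (x : L) : - x = x. Proof. by rewrite -scaleN1r oppF scale1r. Qed.
Let addxx (x : L) : x + x = 0. Proof. by rewrite -{1}[x]oppL addNr. Qed.

Let addl0 s t : size s = 2%N -> size t = 2%N ->
  (rl s + rl t == 0) = (s +l t == zerol G2).
Proof.
move=> _ _; rewrite -rowl_add -rowl_zero; apply/eqP/eqP => [|-> //].
by apply: rowl_inj; rewrite ?size_mkseq ?size_nseq.
Qed.

Lemma rowl_string s t j : rl (stringl s t j) = rl t - rl s *+ j.
Proof.
elim: j => [|j IHj]; first by rewrite mulr0n subr0.
rewrite [stringl s t _]/= -/(stringl s t j) rowl_add rowl_opp IHj.
by rewrite mulrS opprD addrA addrAC.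
Qed.

Lemma brW s t : s \in Rl -> t \in Rl -> s +l t != zerol G2 ->
  br (W s) (W t) = (parity s t)%:R *: W (s +l t).
Proof.
move=> sR tR st0; have [ss st] := (size_root sR, size_root tR).
have mem_add : (rl s + rl t \in R) = (s +l t \in Rl).
  by rewrite -rowl_add mem_roots ?size_mkseq.
rewrite /parity -mem_add; have [stR|stR] := boolP (_ \in R); last first.
  by rewrite scale0r (brV0 dataL) ?rR // addl0.
set m := string_end s t.
have lt_m6 : (m < 6)%N by have /allP/(_ s sR)/allP/(_ t tR) := string_end_lt.
have m_out : rl t - rl s *+ m \notin R.
  have h : has (fun j => stringl s t j \notin Rl) (iota 0 6).
    by rewrite has_find size_iota.
  have := nth_find 0 h; rewrite -/(string_end s t) -/m nth_iota // add0n.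
  case E : (stringl s t m \in Rl) => // _; rewrite -rowl_string mem_roots ?E //.
  by case: (m) => [|j] //; rewrite size_mkseq.
have m_in j : (j < m)%N -> rl t - rl s *+ j \in R.
  move=> lt_jm; have := before_find 0 lt_jm.
  rewrite nth_iota ?(ltn_trans lt_jm) // add0n => /negbT; rewrite negbK => /rR.
  by rewrite rowl_string.
case: m => [|m] in lt_m6 m_out m_in *.
  by move: m_out; rewrite mulr0n subr0 rR.
rewrite -natb /W [rl (_ +l _)]rowl_add.
by have [->|->] := brVstring dataL (rR sR) (rR tR) stR m_in m_out; rewrite ?oppL.
Qed.
Lemma coroot_action s t : s \in Rl -> t \in Rl -> away s t ->
  \sum_j ch j (br (W s) (W (-l s))) * pr (rl t) j = (coroot_parity s t)%:R.
Proof.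
move=> sR tR /andP[ts tsN].
have [ss st] := (size_root sR, size_root tR).
have NsR : -l s \in Rl.
  by rewrite -(mem_roots (X := G2)) ?size_mkseq // rowl_opp rootsN rR.
rewrite -(cv_brV_diag lieL dataL) ?rR //.
have -> : br (br (W s) (W (-l s))) (V (rl t)) =
  br (W s) (br (W (-l s)) (W t)) + br (W (-l s)) (br (W s) (W t)).
  by rewrite [in RHS](br_der lieL (W s)) -addrA addxx addr0.
have sub0 : -l s +l t != zerol G2.
  apply: contra_neq ts => /eqP; rewrite -addl0 ?size_mkseq // rowl_opp addrC subr_eq0.
  by move/eqP/rowl_inj; apply.
have add0 : s +l t != zerol G2.
  apply: contra_neq tsN => /eqP; rewrite -addl0 // addrC addr_eq0 -rowl_opp.
  by move/eqP/rowl_inj; apply; rewrite ?size_mkseq.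
have sK : rl (s +l (t +l -l s)) = rl t.
  by rewrite !rowl_add rowl_opp addrC subrK.
have sK' : rl (-l s +l (s +l t)) = rl t.
  by rewrite !rowl_add rowl_opp addrA addNr add0r.
have addC u u' : u +l u' = u' +l u.
  by apply: eq_mkseq => i; rewrite addrC.
have tne0 u : rl u = rl t -> size u = 2%N -> u != zerol G2.
  move=> eu su; apply: contraTneq (root_neq0 (rR tR)) => e.
  by rewrite -eu e rowl_zero eqxx.
have two k u u' : u \in Rl -> u' \in Rl -> u +l u' != zerol G2 ->
    rl (k +l (u +l u')) = rl t -> k \in Rl ->
    cv (rl t) (br (W k) (br (W u) (W u'))) = (parity u u' && parity k (u +l u'))%:R.
  move=> uR uR' uu0 kuu kR; rewrite brW // (brZr lieL) (scalPZ (cvs _)).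
  case E : (parity u u'); last by rewrite mul0r.
  have /andP[uuR _] := E.
  rewrite brW ?tne0 ?size_mkseq // (scalPZ (cvs _)) /W kuu (cvV dataL) ?rR // eqxx.
  by rewrite !mulr1 mul1r.
rewrite (scalPD (cvs _)) !two //; last by rewrite addC addC; rewrite ?sK //; rewrite [-l s +l t]addC.
rewrite /coroot_parity [t +l -l s]addC.
case: (_ && _); case: (_ && _); rewrite ?addr0 ?add0r //=.
by rewrite -natrD natb.
Qed.

(** These are the two terms of the Leibniz rule for [s] and [- (s + 2 a_1)]; being equal, they
    cancel in characteristic 2. *)
Lemma coroot_shift_eq s : s \in g2_support ->
  br (W s) (W (-l s)) = br (W (s +l g2_shift)) (W (-l (s +l g2_shift))).
Proof.
move=> s_sup; have sR : s \in Rl by move: s s_sup; apply/allP; vm_compute.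
have /allP/(_ s s_sup) sgR := g2_shift_support.
apply: (coord_eq dataL) => [a aR|].
  by rewrite /W !rowl_opp !(brVopp dataL) ?rR.
pose f j := ch j (br (W s) (W (-l s))) - ch j (br (W (s +l g2_shift)) (W (-l (s +l g2_shift)))).
suff f0 : forall j, f j = 0 by move=> j; apply/eqP; rewrite -subr_eq0 -/(f j) f0.
pose phi a := \sum_j f j * pr a j.
have phi0 t : t \in Rl -> away s t -> away (s +l g2_shift) t ->
    coroot_parity s t == coroot_parity (s +l g2_shift) t -> phi (rl t) = 0.
  move=> tR st sgt /eqP e; rewrite /phi; under eq_bigr do rewrite mulrBl.
  by rewrite sumrB !coroot_action // e subrr.
have phiD a b : phi (a + b) = phi a + phi b.
  rewrite /phi -big_split; apply: eq_bigr => j _.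
  by rewrite pairingD intrD mulrDr.
have /allP/(_ s s_sup)/andP[good10 good] := g2_coroot_shift.
have phi10 : phi (rl [:: 1; 0]) = 0.
  by have /and3P[] := good10; apply: phi0; vm_compute.
have phi01 : phi (rl [:: 0; 1]) = 0.
  case/orP: good => /and3P[]; first by apply: phi0; vm_compute.
  move=> a1 a2 a3; have := phi0 [:: 1; 1] _ a1 a2 a3.
  have -> : rl [:: 1; 1] = rl [:: 1; 0] + rl [:: 0; 1] by rewrite -rowl_add.
  by rewrite phiD phi10 add0r; apply; vm_compute.
apply: adj_solve => [|i]; first by rewrite oner_neq0.
transitivity (phi (simple i)).
  by apply: eq_bigr => j _; rewrite pairing_simple.
have [|] : rl [:: 1; 0] = simple i \/ rl [:: 0; 1] = simple i; last by move=> <-.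
  case: i => [[|[]]] // lt_i; [left|right]; apply/rowP => -[[|[]]] // lt_j;
  by rewrite simpleE mxE.
by move=> <-.
Qed.

Lemma g2_derivation : exists2 D, is_derivation br D & ~ is_inner br D.
Proof.
pose g := rl g2_shift.
pose w (a : lattice) : F := (a \in map rl g2_support)%:R.
have supR s : s \in g2_support -> s \in Rl.
  by move: s; apply/allP; vm_compute.
have sup2 s : s \in g2_support -> size s = 2%N by move/supR/size_root.
have wE s : size s = 2%N -> w (rl s) = (s \in g2_support)%:R.
  by move=> ss; rewrite /w mem_rowl.
exists (shift_map V cv w g).
  apply: (shift_map_derivation lieL dataL).
    move=> a i /mapP[s sR ->]; rewrite wE ?(size_root sR) //.
    have [s_sup|] := boolP (s \in g2_support); last by rewrite eqxx.
    have /allP/(_ s s_sup)/rR := g2_shift_support; rewrite rowl_add => sgR _.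
    split=> //; rewrite pairingD intrD.
    have -> : g = 2 *: simple ord0.
      apply/rowP => j; rewrite rowZE simpleE mxE.
      by case: j => [[|[]]].
    by rewrite pairingZ intrM -[(2 : int)%:~R]/(2%:R : F) (pcharf0 char2) mul0r addr0.
  move=> _ _ /mapP[s sR ->] /mapP[t tR ->]; rewrite !wE ?(size_root sR) ?(size_root tR) //.
  have [ss st] := (size_root sR, size_root tR).
  rewrite -/(W s) -/(W t) -!rowl_add -/(W (s +l g2_shift)) -/(W (t +l g2_shift)).
  have lin := shift_map_linear dataL w g.
  have sgR u : u \in g2_support -> u +l g2_shift \in Rl by have /allP := g2_shift_support; apply.
  have addC u u' : u +l u' = u' +l u by apply: eq_mkseq => i; rewrite addrC.
  have addA u u' v : u +l (u' +l v) = u +l u' +l v.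
    by apply/(@rowl_inj G2); rewrite ?size_mkseq // !rowl_add addrA.
  have addAC u u' v : u +l u' +l v = u +l v +l u' by rewrite -addA (addC u') addA.
  have /allP/(_ s sR)/allP/(_ t tR) := g2_shift_leibniz.
  case: eqP => [st0 _|/eqP st0].
    have et : rl t = - rl s.
      by apply/eqP; rewrite -addr_eq0 addrC addl0 // st0.
    have -> : shift_map V cv w g (br (W s) (W t)) = 0.
      by apply: shift_map0 => c cR; rewrite /W et (brVopp dataL) ?rR.
    have shift0 : g2_shift != zerol G2 by vm_compute.
    have shiftN : parity (zerol G2) g2_shift = false by vm_compute.
    have sumE : s +l t +l g2_shift = g2_shift.
      by rewrite st0 addC; vm_compute.
    have par u u' : u +l u' = g2_shift -> parity u u' = false.
      by rewrite /parity => ->; have -> : g2_shift \in Rl = false by vm_compute.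
    have e1 : s +l g2_shift +l t = g2_shift by rewrite addAC sumE.
    have e2 : s +l (t +l g2_shift) = g2_shift by rewrite addA sumE.
    have -> : (s \in g2_support)%:R *: br (W (s +l g2_shift)) (W t) = 0.
      case Es : (s \in g2_support); last by rewrite scale0r.
      by rewrite scale1r brW ?sgR // e1 // par // scale0r.
    rewrite add0r; case Et : (t \in g2_support); last by rewrite scale0r.
    by rewrite scale1r brW ?sgR // e2 // par // scale0r.
  case: eqP => [stg0|/eqP stg0].
    have et : rl t = - rl (s +l g2_shift).
      by apply/eqP; rewrite -addr_eq0 addrC -rowl_add addAC stg0 rowl_zero.
    have etg : rl (t +l g2_shift) = - rl s.
      by apply/eqP; rewrite -addr_eq0 addrC -rowl_add addA stg0 rowl_zero.
    have -> : br (W s) (W t) = 0.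
      rewrite brW // /parity.
      have -> : s +l t = -l g2_shift.
        apply/(@rowl_inj G2); rewrite ?size_mkseq // rowl_opp.
        by apply/eqP; rewrite -addr_eq0 -rowl_add stg0 rowl_zero.
      have -> : (-l g2_shift \in Rl) = false by vm_compute.
      by rewrite andFb scale0r.
    rewrite (linP0 lin) => /eqP <-; case Es : (s \in g2_support); last by rewrite !scale0r addr0.
    have := coroot_shift_eq Es; rewrite /W !rowl_opp et etg => ->.
    by rewrite -scalerDr addxx scaler0.
  have -> : shift_map V cv w g (br (W s) (W t)) =
      (parity s t && (s +l t \in g2_support))%:R *: W (s +l t +l g2_shift).
    rewrite brW // (linPZ lin); case E : (parity s t); last by rewrite !scale0r.
    have /andP[stR _] := E.
    by rewrite scale1r (shift_mapV dataL) ?rR // wE ?size_mkseq // -rowl_add.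
  have -> : (s \in g2_support)%:R *: br (W (s +l g2_shift)) (W t) =
      ((s \in g2_support) && parity (s +l g2_shift) t)%:R *: W (s +l t +l g2_shift).
    case Es : (s \in g2_support); last by rewrite !scale0r.
    by rewrite scale1r brW ?sgR // addAC.
  have -> : (t \in g2_support)%:R *: br (W s) (W (t +l g2_shift)) =
      ((t \in g2_support) && parity s (t +l g2_shift))%:R *: W (s +l t +l g2_shift).
    case Et : (t \in g2_support); last by rewrite !scale0r.
    by rewrite scale1r brW ?sgR // addA.
  case: (parity s t && _); case: (_ && _); case: (_ && _) => //= _;
    by rewrite ?scale1r ?scale0r ?addr0 ?add0r ?addxx.
case=> z Dz.
(* The map sends [V_(a_2)] to [V_(2 a_1 + a_2)], but no bracket ad z does so, the difference [2 a_1]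
   not being a root. *)
have [s01 s21] : [:: 0; 1] \in Rl /\ [:: 2; 1] \in Rl by split; vm_compute.
have := cv_brV lieL dataL z (rR s01) (rR s21).
rewrite -Dz (shift_mapV dataL) ?rR // wE // scale1r -rowl_add.
have -> : addl G2 [:: 0; 1] g2_shift = [:: 2; 1] by vm_compute.
rewrite (cvV dataL) ?rR // eqxx -rowl_opp -rowl_add mem_roots ?size_mkseq //.
have -> : (addl G2 [:: 2; 1] (oppl G2 [:: 0; 1]) \in Rl) = false by vm_compute.
have ne : rl [:: 2; 1] != rl [:: 0; 1].
  by apply/negP => /eqP/rowl_inj ne; have := ne erefl erefl.
by move=> /(_ ne)/eqP; rewrite oner_eq0.
Qed.
End G2Characteristic2.

(** * Root strings in characteristic 0 *)

Lemma split_basis_expand (K : fieldType) (U : lmodType K) (I : eqType) (P : seq I)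
    (r : nat) (vv : I -> U) (hh : 'I_r -> U) (c : nat -> K) (e : nat -> U) :
  uniq P -> (forall a, a \in P -> e (index a P) = vv a) ->
  (forall j : 'I_r, e (size P + j)%N = hh j) ->
  \sum_(m < size P + r) c m *: e m =
  \sum_(a <- P) c (index a P) *: vv a + \sum_(j < r) c (size P + j)%N *: hh j.
Proof.
move=> UP ev eh; rewrite big_split_ord /=; congr (_ + _); last first.
  by apply: eq_bigr => j _; rewrite eh.
transitivity (\sum_(a <- P) c (index a P) *: e (index a P)); last first.
  by apply: eq_big_seq => a /ev ->.
case: P UP {ev eh} => [|a0 P] UP; first by rewrite big_ord0 big_nil.
rewrite (big_nth a0) big_mkord; apply: eq_bigr => i _.
by rewrite index_uniq.
Qed.

Section CharacteristicZero.
Variables (k : fieldType) (char_k : [pchar k] =i pred0).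

Lemma natr_eq0_char0 m : (m%:R == 0 :> k) = (m == 0%N).
Proof. by have /pcharf0P := char_k; apply. Qed.

Lemma intr_eq0_char0 (z : int) : (z%:~R == 0 :> k) = (z == 0).
Proof.
case: z => m; first exact: natr_eq0_char0.
by rewrite NegzE mulrNz oppr_eq0 -[_%:~R]/(m.+1%:R) natr_eq0_char0.
Qed.

Lemma natr_inj_char0 : injective (fun m => m%:R : k).
Proof.
move=> m m' /= /eqP.
wlog le_mm' : m m' / (m <= m')%N => [H|].
  by case: (leqP m m') => [/H //|/ltnW /H e /eqP/esym/eqP/e].
rewrite eq_sym -subr_eq0 -natrB // natr_eq0_char0 subn_eq0 => le_m'm.
by apply/eqP; rewrite eqn_leq le_mm'.
Qed.

Lemma intr_inj_char0 : injective (fun z : int => z%:~R : k).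
Proof.
move=> z z' /= /eqP; rewrite -subr_eq0 -intrB intr_eq0_char0 subr_eq0.
by move/eqP.
Qed.

(** In characteristic 0 the vectors [b + a *+ i] are pairwise distinct, while [P] is finite. *)
Lemma string_end_exists (U : lmodType k) (P : seq U) (a b : U) : a != 0 -> b \in P ->
  exists2 q, (forall i, (i <= q)%N -> b + a *+ i \in P) & b + a *+ q.+1 \notin P.
Proof.
move=> a0 bP; have ex : exists q, b + a *+ q.+1 \notin P.
  have [/hasP[q _ qP]|/hasPn all_in] :=
    boolP (has (fun q => b + a *+ q.+1 \notin P) (iota 0 (size P).+1)).
    by exists q.
  have : uniq (map (fun q => b + a *+ q.+1) (iota 0 (size P).+1)).
    rewrite map_inj_uniq ?iota_uniq // => q q' /addrI/eqP.
    rewrite -!scaler_nat -subr_eq0 -scalerBl scaler_eq0 (negPf a0) orbF subr_eq0.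
    by move/eqP/natr_inj_char0 => -[].
  move/uniq_leq_size => /(_ P) H; suff : ((size P).+1 <= size P)%N by rewrite ltnn.
  rewrite -[X in (X <= _)%N](size_iota 0) -(size_map (fun q => b + a *+ q.+1)); apply: H.
  by move=> _ /mapP[q q_in ->]; have := all_in q q_in; rewrite negbK.
exists (ex_minn ex); case: ex_minnP => // q _ q_min.
case=> [|i] le_iq; first by rewrite mulr0n addr0.
by apply: contraT => /q_min; rewrite leqNgt le_iq.
Qed.
End CharacteristicZero.

Section ChevalleyBasis.
Variables (k : fieldType) (char_k : [pchar k] =i pred0).
Variables (L : vectType k) (br : L -> L -> L).
Hypotheses (lieL : is_lie_bracket br) (simpleL : is_simple_lie br).
Variables (H : {vspace L}) (Phi : seq (dual H)) (PhiP : is_root_system br Phi).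
Variables (r : nat) (alpha : r.-tuple (dual H)).
Variables (v : dual H -> L) (h : r.-tuple L).
Hypothesis chev : is_chevalley_basis br Phi alpha v h.

Local Notation al i := (tnth alpha i).
Local Notation hh i := (tnth h i).

Let B := map v Phi ++ h.
Let UPhi : uniq Phi := PhiP.1.

(** Indexed by all natural numbers, with value 0 out of range, so that positions such as
    [index a Phi] need no proof of a bound. *)
Definition chev_coord (m : nat) (x : L) : k :=
  \sum_(i < size B | val i == m) coord (in_tuple B) i x.
Local Notation cv a := (chev_coord (index a Phi)).
Local Notation ch j := (chev_coord (size Phi + nat_of_ord j)).

Lemma chev_coord_scalar m : scalar (chev_coord m).
Proof.
move=> c x y; rewrite /chev_coord mulr_sumr -big_split; apply: eq_bigr => i _ /=.
by rewrite linearP.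
Qed.

Let cs m := chev_coord_scalar m.

Lemma size_chev : size B = (size Phi + r)%N.
Proof. by rewrite size_cat size_map size_tuple. Qed.

Lemma chev_coordE m m' : (m < size B)%N -> (m' < size B)%N ->
  chev_coord m B`_m' = (m == m')%:R.
Proof.
move=> lt_m lt_m'; have freeB : free (in_tuple B) := basis_free (chev_basis chev).
rewrite /chev_coord (bigD1 (Ordinal lt_m)) //= big1 ?addr0 => [|i /andP[/eqP ei /eqP]].
  by rewrite -[B`_m']/((in_tuple B)`_(Ordinal lt_m')) coord_free // eq_sym.
by case; apply: val_inj.
Qed.

Lemma nth_chev_v a : a \in Phi -> B`_(index a Phi) = v a.
Proof.
move=> aP; rewrite nth_cat size_map index_mem aP (nth_map 0) ?index_mem //.
by rewrite nth_index.
Qed.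

Lemma nth_chev_h (j : 'I_r) : B`_(size Phi + j) = hh j.
Proof. by rewrite nth_cat size_map ltnNge leq_addr addKn (tnth_nth 0). Qed.

Lemma chev_expand x :
  x = \sum_(a <- Phi) cv a x *: v a + \sum_j ch j x *: hh j.
Proof.
rewrite -(split_basis_expand (e := fun m => B`_m) (chev_coord^~ x) UPhi);
  [|exact: nth_chev_v|exact: nth_chev_h].
have x_in : x \in <<in_tuple B>>%VS by rewrite (span_basis (chev_basis chev)) memvf.
rewrite {1}(coord_span x_in) -size_chev; apply: eq_bigr => i _; congr (_ *: _).
by rewrite /chev_coord (bigD1 i) //= big1 ?addr0 // => j /andP[/eqP/val_inj ->]; rewrite eqxx.
Qed.

Lemma index_lt a : a \in Phi -> (index a Phi < size B)%N.
Proof. by move=> aP; rewrite size_chev ltn_addr ?index_mem. Qed.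

Lemma hindex_lt (j : 'I_r) : (size Phi + j < size B)%N.
Proof. by rewrite size_chev ltn_add2l. Qed.

Lemma cv_v a b : a \in Phi -> b \in Phi -> cv a (v b) = (a == b)%:R.
Proof.
move=> aP bP; rewrite -nth_chev_v // chev_coordE ?index_lt //.
congr (nat_of_bool _)%:R; apply/eqP/eqP => [|-> //].
by move/(congr1 (nth 0 Phi)); rewrite !nth_index.
Qed.

Lemma ch_v a (j : 'I_r) : a \in Phi -> ch j (v a) = 0.
Proof.
move=> aP; rewrite -nth_chev_v // chev_coordE ?index_lt ?hindex_lt //.
by rewrite gtn_eqF // ltn_addr ?index_mem.
Qed.

Lemma ch_h (i j : 'I_r) : ch i (hh j) = (i == j)%:R.
Proof. by rewrite -nth_chev_h chev_coordE ?hindex_lt // eqn_add2l. Qed.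

Lemma v_neq0 a : a \in Phi -> v a != 0.
Proof.
move=> aP; apply: contraTneq isT => va0; have := cv_v aP aP.
by rewrite va0 (scalP0 (cs _)) eqxx => /esym/eqP; rewrite oner_eq0.
Qed.

Lemma h_neq0 i : hh i != 0.
Proof.
apply: contraTneq isT => h0; have := ch_h i i.
by rewrite h0 (scalP0 (cs _)) eqxx => /esym/eqP; rewrite oner_eq0.
Qed.

Lemma Phi_neq0 a : a \in Phi -> a != 0.
Proof. by have [_ rootP] := PhiP; move/rootP => -[]. Qed.

Let hs i : subvs_of H := vsproj H (hh i).
Let hsK i : vsval (hs i) = hh i.
Proof. by rewrite vsprojK // (chev_cartan chev). Qed.

Definition coroot_eval (i : 'I_r) (a : dual H) : k := a (hs i).
Local Notation ev i a := (coroot_eval i a).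

Lemma coroot_evalD i a b : ev i (a + b) = ev i a + ev i b.
Proof. by rewrite /coroot_eval add_lfunE. Qed.

Lemma coroot_evalZ i c a : ev i (c *: a) = c * ev i a.
Proof. by rewrite /coroot_eval scale_lfunE. Qed.

Lemma coroot_evalN i a : ev i (- a) = - ev i a.
Proof. by rewrite -scaleN1r coroot_evalZ mulN1r. Qed.

Lemma coroot_evalMn i a m : ev i (a *+ m) = ev i a *+ m.
Proof. by rewrite -scaler_nat coroot_evalZ mulr_natl. Qed.

Lemma br_h_v i a : a \in Phi -> br (hh i) (v a) = ev i a *: v a.
Proof. by move=> aP; rewrite -hsK (chev_root chev aP). Qed.

Lemma coroot_evalE i a : a \in Phi -> ev i a = cartan_int br a (al i).
Proof.
move=> aP; have := chev_hv chev i aP; rewrite br_h_v // => /eqP.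
rewrite -subr_eq0 -scalerBl scaler_eq0 (negPf (v_neq0 aP)) orbF subr_eq0.
by move/eqP.
Qed.

Lemma br_h_expand i x :
  br (hh i) x = \sum_(a <- Phi) (ev i a * cv a x) *: v a.
Proof.
rewrite {1}[x]chev_expand (brDr lieL) !(br_sumr lieL) [X in _ + X]big1 ?addr0 => [|j _].
  by apply: eq_big_seq => a aP; rewrite br_h_v // scalerA mulrC.
by rewrite (chev_hh chev) scaler0.
Qed.

Lemma ch_br_h (j i : 'I_r) x : ch j (br (hh i) x) = 0.
Proof.
rewrite br_h_expand (scalP_sum (cs _)) big_seq big1 // => a aP.
by rewrite ch_v // mulr0.
Qed.

Hypothesis alphaP : is_base Phi alpha.

Lemma al_in i : al i \in Phi.
Proof. by have [sub _ _] := alphaP; rewrite sub ?mem_tnth. Qed.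

(* Otherwise h_i would be central. *)
Lemma form_al_neq0 i : Defs.form br (al i) (al i) != 0.
Proof.
apply/negP => /eqP f0; have central x : br (hh i) x = 0.
  rewrite br_h_expand big_seq big1 // => a aP.
  by rewrite coroot_evalE // /cartan_int f0 invr0 mulr0 mul0r scale0r.
have [[x [y xy0]] ideals] := simpleL.
have centralr z u : u \in <[hh i]>%VS -> br z u = 0.
  by case/vlineP => c ->; rewrite (brZr lieL) (brC lieL) central oppr0 scaler0.
have [|line0|line_full] := ideals <[hh i]>%VS.
- by move=> z u /centralr ->; rewrite mem0v.
- by have := memv_line (hh i); rewrite line0 memv0 (negPf (h_neq0 i)).
by move: xy0; rewrite centralr ?eqxx // line_full memvf.
Qed.

Lemma coroot_eval_al i : ev i (al i) = 2.
Proof. by rewrite coroot_evalE ?al_in // /cartan_int mulfK ?form_al_neq0. Qed.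

Let two_neq0 : (2 : k) != 0. Proof. by rewrite natr_eq0_char0. Qed.

Lemma not_free2 (a b : dual H) : a != 0 -> b != 0 -> ~~ free [:: a; b] ->
  exists c : k, b = c *: a.
Proof.
move=> a0 b0; rewrite free_cons seq1_free b0 andbT negbK span_seq1.
case/vlineP => c ea; exists c^-1; rewrite ea scalerA mulVf ?scale1r //.
by apply: contraNneq a0 => c0; rewrite ea c0 scale0r.
Qed.

Lemma string_exists (a b : dual H) : a \in Phi -> b \in Phi ->
  exists s q, is_string Phi a b s q.
Proof.
move=> aP bP; have a0 := Phi_neq0 aP.
have [q q_in q_out] := string_end_exists char_k a0 bP.
have [|s s_in s_out] := string_end_exists char_k (a := - a) _ bP; first by rewrite oppr_eq0.
exists s, q; split=> // [i /s_in|]; first by rewrite mulNrn.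
by move: s_out; rewrite mulNrn.
Qed.

Lemma br_free a b : a \in Phi -> b \in Phi -> free [:: a; b] ->
  exists2 c, br (v a) (v b) = c *: v (a + b) &
             a + b \notin Phi -> br (v a) (v b) = 0.
Proof.
move=> aP bP fab; have [s [q str]] := string_exists aP bP.
have [q0 sum_in] := chev_string chev aP bP fab str.
have [abP|abP] := boolP (a + b \in Phi).
  have [->|->] := sum_in abP; first by exists s.+1%:R.
  by exists (- s.+1%:R); rewrite ?scaleNr.
suff -> : br (v a) (v b) = 0 by exists 0; rewrite ?scale0r.
apply: q0; case: (q) str => // q' [_ /(_ 1%N) + _ _].
by rewrite mulr1n addrC (negPf abP) => /(_ isT).
Qed.

(** If [b = c *: al i], the string relation does not apply. But ad h_i then multiplies the bracket
    by 2 (1 + c), whereas the image of ad h_i has no component along the h_j; so these components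
    vanish unless c = -1. *)
Lemma ch_br_al i b (j : 'I_r) : b \in Phi -> b != - al i ->
  ch j (br (v (al i)) (v b)) = 0.
Proof.
move=> bP bN; have aP := al_in i.
have [fab|/not_free2] := boolP (free [:: al i; b]).
  have [c e out] := br_free aP bP fab.
  have [abP|abP] := boolP (al i + b \in Phi).
    by rewrite e (scalPZ (cs _)) ch_v // mulr0.
  by rewrite out ?(scalP0 (cs _)).
move=> /(_ (Phi_neq0 aP) (Phi_neq0 bP))[c eb].
have e : br (hh i) (br (v (al i)) (v b)) = (2 + c * 2) *: br (v (al i)) (v b).
  rewrite (br_der lieL) !br_h_v // (brZl lieL) (brZr lieL) -scalerDl.
  by rewrite eb coroot_evalZ coroot_eval_al.
have := congr1 (ch j) e; rewrite ch_br_h (scalPZ (cs _)) => /esym/eqP.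
rewrite mulf_eq0 => /orP[|/eqP //]; rewrite -[X in X + _]mul1r -mulrDl mulf_eq0.
rewrite (negPf two_neq0) orbF addrC addr_eq0 => /eqP c1.
by move: bN; rewrite eb c1 scaleN1r eqxx.
Qed.

(* The value of v at - alpha_i is a priori arbitrary; but if - alpha_i were not a
   root, no bracket with v_(alpha_i) would have a component along h_i. *)
Lemma alN_in i : - al i \in Phi.
Proof.
apply: contraT => NaP; have := ch_h i i.
rewrite -(chev_simple chev) {1}[v (- _)]chev_expand (brDr lieL) !(br_sumr lieL).
rewrite (scalPD (cs _)) !(scalP_sum (cs _)) eqxx [X in X + _]big_seq.
rewrite !big1 ?addr0 => [/esym/eqP||]; first by rewrite oner_eq0.
  move=> j _; rewrite (brC lieL) br_h_v ?al_in // (scalPN (cs _)) (scalPZ (cs _)).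
  by rewrite (ch_v i (al_in i)) mulr0 oppr0 mulr0.
move=> b bP; rewrite ch_br_al ?mulr0 //.
by apply: contraNneq NaP => <-.
Qed.

(** It is not assumed that the h_i span [H]; but h_i is a bracket of vectors of opposite weights, so
    [H] acts on it by 0. *)
Lemma br_H_h (y : subvs_of H) i : br (vsval y) (hh i) = 0.
Proof.
rewrite -(chev_simple chev) (br_der lieL).
rewrite !(chev_root chev) ?al_in ?alN_in // (brZl lieL) (brZr lieL) -scalerDl.
by rewrite opp_lfunE addrN scale0r.
Qed.

Lemma br_H_expand (y : subvs_of H) x :
  br (vsval y) x = \sum_(a <- Phi) ((a y : k) * cv a x) *: v a.
Proof.
rewrite {1}[x]chev_expand (brDr lieL) !(br_sumr lieL) [X in _ + X]big1 ?addr0 => [|j _].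
  by apply: eq_big_seq => a aP; rewrite (chev_root chev) // scalerA mulrC.
by rewrite br_H_h scaler0.
Qed.

Lemma cv_sum (f : dual H -> k) a : a \in Phi ->
  cv a (\sum_(b <- Phi) f b *: v b) = f a.
Proof.
move=> aP; rewrite (scalP_sum (cs _)) (single_term UPhi aP) => [|b bP neq].
  by rewrite cv_v // eqxx mulr1.
by rewrite cv_v // eq_sym (negPf neq) mulr0.
Qed.

Lemma weight_cv (a b : dual H) x : in_root_space br a x -> b \in Phi -> b != a -> cv b x = 0.
Proof.
move=> ax bP; apply: contra_neq_eq => cx.
apply/lfunP => y; have := congr1 (cv b) (ax y).
rewrite br_H_expand (cv_sum (fun a => (a y : k) * cv a x)) // (scalPZ (cs _)).
by move/(mulIf cx).
Qed.

Lemma weight_ch (a : dual H) x (j : 'I_r) : in_root_space br a x -> a != 0 -> ch j x = 0.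
Proof.
move=> ax; apply: contra_neq_eq => cx.
apply/lfunP => y; have := congr1 (ch j) (ax y).
rewrite br_H_expand (scalP_sum (cs _)) big_seq big1 => [|b bP]; last first.
  by rewrite ch_v // mulr0.
rewrite (scalPZ (cs _)) zero_lfunE => /esym/eqP.
by rewrite mulf_eq0 (negPf cx) orbF => /eqP.
Qed.

Lemma weight_br (a b : dual H) x z : in_root_space br a x -> in_root_space br b z ->
  in_root_space br (a + b) (br x z).
Proof.
move=> ax bz y; rewrite (br_der lieL) ax bz (brZl lieL) (brZr lieL) -scalerDl.
by rewrite add_lfunE.
Qed.

Lemma weight_out (a : dual H) x : in_root_space br a x -> a != 0 -> a \notin Phi -> x = 0.
Proof.
move=> ax a0 aP; rewrite [x]chev_expand big_seq !big1 ?addr0 // => [j _|b bP].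
  by rewrite (weight_ch _ ax) // scale0r.
by rewrite (weight_cv ax) ?scale0r //; apply: contraNneq aP => <-.
Qed.

Lemma weight_line (a : dual H) x : in_root_space br a x -> a \in Phi -> x = cv a x *: v a.
Proof.
move=> ax aP; rewrite {1}[x]chev_expand [X in _ + X]big1 => [|j _]; last first.
  by rewrite (weight_ch _ ax) ?Phi_neq0 ?scale0r.
rewrite addr0 (single_term UPhi aP) // => b bP neq.
by rewrite (weight_cv ax) ?scale0r.
Qed.

Lemma weight_v a : a \in Phi -> in_root_space br a (v a).
Proof. exact: (chev_root chev). Qed.

(* The trace of [e, f] vanishes on a stable string of root vectors: the partial
   traces telescope. *)
Lemma string_trace (b0 : dual H) (c : dual H -> k) (b : dual H) (m : nat) :
  b0 \in Phi -> - b0 \in Phi ->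
  (forall a, a \in Phi -> br (br (v b0) (v (- b0))) (v a) = c a *: v a) ->
  (forall j, c (b + b0 *+ j) = c b + 2 *+ j) ->
  (forall j, (j <= m)%N -> b + b0 *+ j \in Phi) ->
  br (v b0) (br (v (- b0)) (v b)) = 0 ->
  br (v (- b0)) (br (v b0) (v (b + b0 *+ m))) = 0 ->
  c b = - m%:R.
Proof.
move=> b0P Nb0P cP cD bP first0 last0; set e := v b0; set f := v (- b0).
pose u j := v (b + b0 *+ j).
pose S j := \sum_(l < j.+1) c (b + b0 *+ l).
have u0 j : (j <= m)%N -> u j != 0 by move=> /bP/v_neq0.
have comm j : (j <= m)%N -> br f (br e (u j)) = br e (br f (u j)) - c (b + b0 *+ j) *: u j.
  by move=> /bP/cP <-; rewrite [in RHS](br_der lieL e f) addrAC subrr add0r.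
have partial j : (j <= m)%N -> br f (br e (u j)) = - S j *: u j.
  elim: j => [|j IHj] le_jm.
    rewrite comm // /S big_ord1 /u mulr0n addr0 first0 add0r scaleNr.
    by [].
  have le_jm' := ltnW le_jm.
  have [n en] : exists n, br e (u j) = n *: u j.+1.
    exists (cv (b + b0 *+ j.+1) (br e (u j))); apply: weight_line; last exact: bP.
    by rewrite mulrS addrCA; apply: weight_br; apply: weight_v; rewrite ?bP.
  have [n' en'] : exists n', br f (u j.+1) = n' *: u j.
    exists (cv (b + b0 *+ j) (br f (u j.+1))); apply: weight_line; last exact: bP.
    have -> : b + b0 *+ j = - b0 + (b + b0 *+ j.+1) by rewrite mulrS addrCA addKr.
    by apply: weight_br; apply: weight_v; rewrite ?bP.
  rewrite comm // en' (brZr lieL) en scalerA.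
  (* The scalar [n * n'] occurs both in f e on [u j] and in e f on [u j.+1]: this is what makes the
     sums telescope. *)
  have : (n * n') *: u j = - S j *: u j by rewrite -IHj // en (brZr lieL) en' scalerA.
  move/eqP; rewrite -subr_eq0 -scalerBl scaler_eq0 (negPf (u0 _ le_jm')) orbF subr_eq0.
  move/eqP; rewrite mulrC => ->; rewrite -scalerBl [in RHS]/S [in RHS]big_ord_recr /= opprD.
  by [].
have := partial m (leqnn m); rewrite last0 => /esym/eqP.
rewrite scaler_eq0 (negPf (u0 _ (leqnn m))) orbF oppr_eq0 => /eqP.
have -> : S m = m.+1%:R * (c b + m%:R).
  rewrite /S; elim: (m) => [|j IHj]; first by rewrite big_ord1 mulr0n !addr0 mul1r.
  rewrite big_ord_recr /= IHj cD -mulr_natr; ring.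
move/eqP; rewrite mulf_eq0 natr_eq0_char0 //= addr_eq0 => /eqP ->.
by [].
Qed.

(** Take the least l > 1 with [b0 *+ l] a root. The upward string from it is stable: lowering its
    first vector gives 0, or, when l = 2, a multiple of [v b0], which is then killed by [v b0]. The
    trace gives [c (b0 *+ l) = - q], against the value 2 l. *)
Lemma no_multiple (b0 : dual H) (c : dual H -> k) m :
  b0 \in Phi -> - b0 \in Phi ->
  (forall a, a \in Phi -> br (br (v b0) (v (- b0))) (v a) = c a *: v a) ->
  (forall b j, c (b + b0 *+ j) = c b + 2 *+ j) -> c 0 = 0 ->
  (1 < m)%N -> b0 *+ m \notin Phi.
Proof.
move=> b0P Nb0P cP cD c0 m_gt1; apply/negP => b0m.
have ex : exists l, (1 < l)%N && (b0 *+ l \in Phi) by exists m; rewrite m_gt1.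
have b0N0 l : (0 < l)%N -> b0 *+ l != 0.
  move=> l0; rewrite -scaler_nat scaler_eq0 (natr_eq0_char0 char_k) (negPf (Phi_neq0 b0P)).
  by rewrite orbF -lt0n.
have [l /andP[l_gt1 lP] l_min] := ex_minnP ex.
have [q q_in q_out] := string_end_exists char_k (Phi_neq0 b0P) lP.
have : c (b0 *+ l) = - q%:R.
  apply: (string_trace b0P Nb0P cP) => //.
    have w : in_root_space br (b0 *+ l.-1) (br (v (- b0)) (v (b0 *+ l))).
      have -> : b0 *+ l.-1 = - b0 + b0 *+ l.
        by rewrite -{2}(prednK (ltnW l_gt1)) mulrS addKr.
      by apply: weight_br; apply: weight_v.
    have [l2|l_neq2] := eqVneq l.-1 1%N.
      rewrite l2 mulr1n in w.
      by rewrite (weight_line w b0P) (brZr lieL) (lie_alternating lieL) scaler0.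
    rewrite (weight_out w) ?(br0r lieL) ?b0N0 //; first by case: (l) l_gt1.
    apply: contraNN l_neq2 => lP'; have := l_min l.-1; rewrite lP' andbT.
    case: (l) l_gt1 => [|[|[|l']]] //= _ /(_ isT); by rewrite ltnn.
  have w : in_root_space br (b0 *+ l + b0 *+ q.+1) (br (v b0) (v (b0 *+ l + b0 *+ q))).
    by rewrite mulrS addrCA; apply: weight_br; apply: weight_v; rewrite ?q_in.
  by rewrite (weight_out w) ?(br0r lieL) // -mulrnDr b0N0 // addnS.
rewrite -[b0 *+ l]add0r cD c0 add0r => /eqP; rewrite -addr_eq0 -mulrnA -natrD.
by rewrite (natr_eq0_char0 char_k) addn_eq0 muln_eq0 /=; case: (l) l_gt1.
Qed.

Lemma coroot_eval_string i b j : ev i (b + al i *+ j) = ev i b + 2 *+ j.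
Proof. by rewrite coroot_evalD coroot_evalMn coroot_eval_al. Qed.

Lemma br_coroot i a : a \in Phi ->
  br (br (v (al i)) (v (- al i))) (v a) = ev i a *: v a.
Proof. by move=> aP; rewrite (chev_simple chev) br_h_v. Qed.

Lemma al_multiple i m : (1 < m)%N -> al i *+ m \notin Phi.
Proof.
apply: (no_multiple (c := coroot_eval i)); rewrite ?al_in ?alN_in //.
- exact: br_coroot.
- exact: coroot_eval_string.
by rewrite /coroot_eval zero_lfunE.
Qed.

Lemma alN_multiple i m : (1 < m)%N -> - (al i *+ m) \notin Phi.
Proof.
rewrite -mulNrn; apply: (no_multiple (c := fun a => - coroot_eval i a)).
- exact: alN_in.
- by rewrite opprK al_in.
- by move=> a aP; rewrite opprK (brC lieL (v _) (v _)) (brNl lieL) br_coroot // scaleNr.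
- move=> b j; rewrite mulNrn coroot_evalD coroot_evalN coroot_evalMn coroot_eval_al.
  by rewrite opprD opprK.
by rewrite /coroot_eval zero_lfunE oppr0.
Qed.

Lemma free_comb_neq0 (a b : dual H) (c : k) : free [:: a; b] -> b + c *: a != 0.
Proof.
rewrite free_cons seq1_free span_seq1 => /andP[a_out b0].
apply: contraNneq a_out => e; have cN0 : c != 0.
  by apply: contraNneq b0 => c0; rewrite -e c0 scale0r addr0.
apply/vlineP; exists (- c^-1); move/eqP: e; rewrite addrC addr_eq0 => /eqP e.
by rewrite scaleNr -scalerN -e scalerA mulVf // scale1r.
Qed.

Lemma al_string i (b : dual H) s q : b \in Phi -> free [:: al i; b] ->
  is_string Phi (al i) b s q ->
  ev i b = s%:R - q%:R /\ b - al i *~ (s%:Z - q%:Z) \in Phi.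
Proof.
move=> bP fab [s_in q_in s_out q_out].
have strP j : (j <= s + q)%N -> b - al i *+ s + al i *+ j \in Phi.
  move=> le_j; have [le_js|lt_sj] := leqP j s.
    rewrite -{1}(subnK le_js) mulrnDr opprD addrA subrK.
    by rewrite s_in // leq_subr.
  rewrite -{1}(subnK (ltnW lt_sj)) mulrnDr addrA addrAC subrK.
  by rewrite q_in // leq_subLR.
(* The trace is taken over the whole string, from its lower end. As s - q lies between - q and s,
   the reflection of [b] is again on the string. *)
have : ev i (b - al i *+ s) = - (s + q)%:R.
  apply: (string_trace (c := coroot_eval i) (al_in i) (alN_in i)) => //.
  - exact: br_coroot.
  - by move=> j; apply: coroot_eval_string.
  - have w : in_root_space br (b - al i *+ s.+1) (br (v (- al i)) (v (b - al i *+ s))).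
      rewrite mulrS opprD addrCA; apply: weight_br; apply: weight_v; rewrite ?alN_in //.
      exact: s_in.
    rewrite (weight_out w) ?(br0r lieL) //.
    by rewrite -scaler_nat -scaleNr free_comb_neq0.
  have -> : b - al i *+ s + al i *+ (s + q) = b + al i *+ q.
    by rewrite mulrnDr addrA subrK.
  have w : in_root_space br (b + al i *+ q.+1) (br (v (al i)) (v (b + al i *+ q))).
    rewrite mulrS addrCA; apply: weight_br; apply: weight_v; rewrite ?al_in //.
    exact: q_in.
  by rewrite (weight_out w) ?(br0r lieL) // -scaler_nat free_comb_neq0.
rewrite coroot_evalD coroot_evalN coroot_evalMn coroot_eval_al => e; split.
  by rewrite -[ev i b](subrK (2 *+ s)) e -[2 *+ s]mulr_natr natrD; ring.
have [le_qs|lt_sq] := leqP q s.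
  by rewrite subzn // s_in // leq_subr.
rewrite -[s%:Z - q%:Z]opprB mulrNz opprK subzn ?(ltnW lt_sq) // q_in // leq_subr.
by [].
Qed.

Lemma killingC x y : killing br x y = killing br y x.
Proof.
by rewrite /killing /lfun_tr !(passmx.mxof_comp _ _ (vbasisP _)) mxtrace_mulC.
Qed.

Lemma formC (a b : dual H) : Defs.form br a b = Defs.form br b a.
Proof. exact: killingC. Qed.

(** * The Cartan matrix and the roots from the Dynkin diagram *)

Section Diagram.
Variables (X : exceptional_type).
Local Notation n := (dynkin_rank X).
Local Notation lattice := 'rV[int]_n.
Variables (f : 'I_r -> 'I_n) (f' : 'I_n -> 'I_r).
Hypotheses (fK : cancel f f') (f'K : cancel f' f).
Hypothesis diagram : forall i j, i != j ->
  cartan_int br (al i) (al j) * cartan_int br (al j) (al i)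
    = (dynkin_mult X (f i) (f j))%:R /\
  (dynkin_arrow X (f i) (f j) <->
   Defs.form br (al i) (al j) != 0 /\ longer br (al i) (al j)).

Local Notation bl i := (al (f' i)).
Definition root_of_row (x : lattice) : dual H := \sum_i bl i *~ x 0 i.
Local Notation toM := root_of_row.

Lemma root_of_rowD x y : toM (x + y) = toM x + toM y.
Proof. by rewrite -big_split; apply: eq_bigr => i _; rewrite rowDE mulrzDr. Qed.

Lemma root_of_rowZ c x : toM (c *: x) = toM x *~ c.
Proof.
rewrite /root_of_row mulrz_suml; apply: eq_bigr => i _.
by rewrite rowZE mulrC mulrzA.
Qed.

Lemma root_of_rowN x : toM (- x) = - toM x.
Proof. by rewrite -scaleN1r root_of_rowZ mulrNz mulr1z. Qed.

Lemma root_of_row_simple i : toM (simple i) = bl i.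
Proof.
rewrite /root_of_row (bigD1 i) //= simple_diag mulr1z big1 ?addr0 // => j neq.
by rewrite simpleE (negPf neq) mulr0z.
Qed.

Lemma bl_free (c : 'I_n -> k) : \sum_i c i *: bl i = 0 -> forall i, c i = 0.
Proof.
have [_ /freeP free_al _] := alphaP.
rewrite (reindex f); last by exists f' => ? _; [exact: fK | exact: f'K].
move=> c0 i; rewrite -[i]f'K; move: (f' i); apply: free_al.
by rewrite -[RHS]c0; apply: eq_bigr => j _; rewrite fK (tnth_nth 0).
Qed.

Lemma root_of_rowE x : toM x = \sum_i (x 0 i)%:~R *: bl i.
Proof. by apply: eq_bigr => i _; rewrite scaler_int. Qed.

Lemma root_of_row_eq0 x : toM x = 0 -> x = 0.
Proof.
rewrite root_of_rowE => /bl_free x0; apply/rowP => i; rewrite mxE.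
by apply/eqP; rewrite -(intr_eq0_char0 char_k) x0.
Qed.

Lemma root_of_row_inj : injective toM.
Proof.
move=> x y e; apply/eqP; rewrite -subr_eq0; apply/eqP; apply: root_of_row_eq0.
by rewrite root_of_rowD root_of_rowN e subrr.
Qed.

Lemma root_row b : b \in Phi -> exists2 x, b = toM x &
  (forall j, 0 <= x 0 j) \/ (forall j, x 0 j <= 0).
Proof.
have [_ _ comb] := alphaP; move=> /comb[c].
have E : toM (\row_i (c (f' i))%:Z) = \sum_i al i *+ c i.
  rewrite [RHS](reindex f'); last by exists f => ? _; [exact: f'K | exact: fK].
  by apply: eq_bigr => i _; rewrite mxE.
case=> ->; [exists (\row_i (c (f' i))%:Z) | exists (- \row_i (c (f' i))%:Z)].
- by rewrite E.
- by left=> j; rewrite mxE.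
- by rewrite root_of_rowN E.
by right=> j; rewrite rowNE mxE oppr_le0.
Qed.

Lemma root_row_sign x : toM x \in Phi ->
  (forall j, 0 <= x 0 j) \/ (forall j, x 0 j <= 0).
Proof. by case/root_row => y /root_of_row_inj ->. Qed.

Lemma bl_free2 x i j : toM x \in Phi -> j != i -> x 0 j != 0 ->
  free [:: bl i; toM x].
Proof.
move=> xP neq xj; apply: contraT => /not_free2[||c]; rewrite ?Phi_neq0 ?al_in //.
rewrite root_of_rowE => e.
have /bl_free/(_ j) : \sum_l ((x 0 l)%:~R - (if l == i then c else 0)) *: bl l = 0.
  under eq_bigr do rewrite scalerBl; rewrite sumrB e (bigD1 (P := predT) i) //= eqxx.
  by rewrite big1 ?addr0 ?subrr // => l /negPf ->; rewrite scale0r.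
by rewrite (negPf neq) subr0 => /eqP; rewrite intr_eq0_char0 // (negPf xj).
Qed.

Lemma bl_sub i j : i != j -> bl j - bl i \notin Phi.
Proof.
move=> neq; apply/negP.
rewrite -!root_of_row_simple -root_of_rowN -root_of_rowD.
case/root_row_sign => sgn.
  by have := sgn i; rewrite rowDE rowNE simple_diag simpleE (negPf neq) add0r.
have := sgn j; rewrite rowDE rowNE simple_diag simpleE eq_sym (negPf neq) subr0.
by [].
Qed.

(** A difference of two simple roots has coefficients of both signs, so the string starts at [bl j]
    and s = 0. The second clause, symmetric in i and j, makes the two pairings vanish together. *)
Lemma bl_pairing i j : i != j ->
  exists2 q : nat, coroot_eval (f' i) (bl j) = - q%:R & (q == 0%N) = (bl i + bl j \notin Phi).
Proof.
move=> neq; have fij : free [:: bl i; bl j].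
  rewrite -[bl j]root_of_row_simple; apply: (bl_free2 (j := j)).
  - by rewrite root_of_row_simple al_in.
  - by rewrite eq_sym.
  - by rewrite simple_diag.
have [s [q str]] := string_exists (al_in (f' i)) (al_in (f' j)).
have [-> _] := al_string (al_in (f' j)) fij str.
have [s_in q_in s_out q_out] := str; exists q.
  case: s s_in {str s_out} => [_|s /(_ 1%N isT)]; first by rewrite sub0r.
  by rewrite mulr1n (negPf (bl_sub neq)).
apply/eqP/idP => [q0|]; first by move: q_out; rewrite q0 mulr1n addrC.
by case: (q) q_in => // q' /(_ 1%N isT); rewrite mulr1n addrC => ->.
Qed.

Lemma dynkin_multE i j : dynkin_mult X i j =
  sumn [seq e.2 | e <- dynkin_edges X & (e.1 == (i, j)) || (e.1 == (j, i))].
Proof. by rewrite sumnE big_map big_filter. Qed.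

(** By symmetry of the form, a / b is the ratio of the squared lengths. It is compared with the
    rational ratio through integers, as [k] has no order. *)
Lemma longer_ratio i j a b :
  coroot_eval (f' j) (bl i) = - a%:R -> coroot_eval (f' i) (bl j) = - b%:R ->
  (0 < b)%N -> longer br (bl i) (bl j) -> (b < a)%N.
Proof.
rewrite !coroot_evalE ?al_in // /cartan_int => ea eb b_gt0 [q q_gt1 eq_q].
have f0 l : Defs.form br (bl l) (bl l) != 0 by exact: form_al_neq0.
have e1 : a%:R * Defs.form br (bl j) (bl j) = b%:R * Defs.form br (bl i) (bl i).
  apply: oppr_inj; rewrite -!mulNr -ea -eb !divfK //.
  by rewrite formC.
have q_den : (denq q)%:~R != 0 :> k by rewrite intr_eq0_char0 // denq_eq0.
move: e1; rewrite eq_q mulrA => /(mulIf (f0 j)); rewrite /ratr => e1.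
have {}e1 : (a%:Z * denq q)%:~R = (b%:Z * numq q)%:~R :> k.
  by rewrite !intrM -[a%:Z%:~R]/(a%:R) e1 -mulrA divfK.
have {}e1 := intr_inj_char0 char_k e1.
have num_gt : denq q < numq q.
  by rewrite -[q]divq_num_den ltr_pdivlMr ?ltr0z // mul1r ltr_int in q_gt1.
rewrite -ltz_nat -(ltr_pM2r (denq_gt0 q)) e1 ltr_pM2l //.
Qed.

Lemma diagram_cases : all (fun i => all (fun j => (i == j) ||
  let m := sumn [seq e.2 | e <- dynkin_edges X & (e.1 == (i, j)) || (e.1 == (j, i))] in
  if (m <= 1)%N then ~~ dynkin_arrow X i j && ~~ dynkin_arrow X j i
  else (m <= 3)%N && (dynkin_arrow X i j (+) dynkin_arrow X j i)) (iota 0 n)) (iota 0 n).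
Proof. by case: (X); vm_compute. Qed.

Lemma small_product a b : (0 < a)%N -> (a < b)%N -> (a * b <= 3)%N -> a = 1%N.
Proof.
case: a => [|[|a]] // _ lt_ab; have le6 : (2 * 3 <= a.+2 * b)%N.
  by apply: leq_mul => //; apply: leq_trans lt_ab.
by move/(leq_trans le6).
Qed.

(** The diagram gives the product of two natural numbers that vanish together. A product at most 1
    determines both; if it is 2 or 3, the smaller factor is 1 and the arrow tells which one it
    is. *)
Lemma coroot_eval_bl i j : coroot_eval (f' j) (bl i) = (cartan X i j)%:~R.
Proof.
rewrite mxE /cartan_entry; case: eqP => [/val_inj ->|/eqP neq_ij]; first exact: coroot_eval_al.
have neq : i != j by [].
have neq' : j != i by rewrite eq_sym.
have [a ea a0] := bl_pairing neq'; have [b eb b0] := bl_pairing neq.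
rewrite addrC -b0 in a0.
have fneq : f' i != f' j by rewrite (can_eq f'K).
have fneq' : f' j != f' i by rewrite eq_sym.
have [em arrow_ij] := diagram fneq; have [_ arrow_ji] := diagram fneq'.
rewrite !f'K in em arrow_ij arrow_ji.
have {}em : (a * b)%N = dynkin_mult X i j.
  apply: (natr_inj_char0 char_k) => /=.
  by rewrite -em -!coroot_evalE ?al_in // ea eb mulrNN natrM.
have /allP_iota/(_ i)/allP_iota/(_ j) := diagram_cases.
rewrite (negPf neq_ij) -dynkin_multE /= -em ea; set m := (a * b)%N.
have lt_ba : dynkin_arrow X i j -> (0 < b)%N -> (b < a)%N.
  by move=> /arrow_ij[_ long] b_gt0; apply: longer_ratio long.
have lt_ab : dynkin_arrow X j i -> (0 < a)%N -> (a < b)%N.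
  by move=> /arrow_ji[_ long] a_gt0; apply: longer_ratio long.
have neg (c : nat) : (- c%:Z)%:~R = - c%:R :> k by rewrite mulrNz.
case: leqP => [m_le1 /andP[_ /negPf ->]|m_gt1 /andP[m_le3]].
  rewrite neg; congr (- _%:R); move: m_le1; rewrite /m.
  case: (a) (b) a0 => [|[|a']] [|[|b']] //= _; by rewrite ?mulnS ?muln1 ?addnS.
have a_gt0 : (0 < a)%N by move: m_gt1; rewrite /m; case: (a).
have b_gt0 : (0 < b)%N by move: m_gt1; rewrite /m mulnC; case: (b).
case: ifP => [ji _|_]; last rewrite addbF => ij.
  by rewrite (small_product a_gt0 (lt_ab ji a_gt0)) // mulrNz.
by rewrite neg /m (small_product b_gt0 (lt_ba ij b_gt0)) ?muln1 // mulnC.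
Qed.

Lemma coroot_eval_row x j : coroot_eval (f' j) (toM x) = (pairing (cartan X) x j)%:~R.
Proof.
rewrite root_of_rowE /coroot_eval sum_lfunE /pairing mxE rmorph_sum /=.
apply: eq_bigr => i _; rewrite scale_lfunE intrM -coroot_eval_bl.
by [].
Qed.

(** Multiples of [simple i] are set apart because [al_string] requires independence. The coordinate
    [j] of the second clause is unchanged by the reflection and later fixes the sign of the
    reflected root. *)
Lemma root_row_reflection x i : toM x \in Phi -> x != simple i -> x != - simple i ->
  toM (reflection (cartan X) i x) \in Phi /\
  exists2 j, j != i & x 0 j != 0.
Proof.
move=> xP neq neqN.
have [/existsP[j /andP[ji xj]]|/existsPn only_i] := boolP [exists j, (j != i) && (x 0 j != 0)].
  split; last by exists j.
  have fx := bl_free2 xP ji xj.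
  have [s [q str]] := string_exists (al_in (f' i)) xP.
  have [e in_refl] := al_string xP fx str.
  rewrite root_of_rowD root_of_rowN root_of_rowZ root_of_row_simple.
  suff -> : pairing (cartan X) x i = s%:Z - q%:Z by [].
  by apply: (intr_inj_char0 char_k) => /=; rewrite -coroot_eval_row e intrB.
have eq_x : x = x 0 i *: simple i.
  apply/rowP => j; rewrite rowZE simpleE; have [->|ji] := eqVneq j i; first by rewrite mulr1.
  by rewrite mulr0; apply/eqP; have := only_i j; rewrite ji negbK.
move: xP neq neqN; rewrite eq_x root_of_rowZ root_of_row_simple.
case: (x 0 i) => m; last first.
  rewrite NegzE mulrNz => xP _; have := alN_multiple (f' i) (m := m.+1).
  by rewrite xP; case: m {xP} => [|m] => [_|/(_ isT)] //; rewrite scaleN1r eqxx.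
move=> xP; have := al_multiple (f' i) (m := m).
case: m xP => [|[|m]] xP; first by have := Phi_neq0 xP; rewrite mulr0z eqxx.
  by rewrite scale1r eqxx.
by rewrite xP => /(_ isT).
Qed.

(** The positive and the negative half of [Phi] (c = 1 and c = -1) are each shown to be a positive
    system, since at this point stability under negation is known only for the simple roots. *)
Lemma root_rowP x : (toM x \in Phi) = (x \in root_vectors X).
Proof.
have ps (c : int) : c = 1 \/ c = -1 -> positive_system (cartan X)
    (fun x => toM (c *: x) \in Phi /\ forall j, 0 <= x 0 j).
  move=> c1; have cK (y : lattice) : c *: (c *: y) = y.
    by case: c1 => ->; rewrite ?scale1r // !scaleN1r opprK.
  split=> [i|y [yP y_ge0]|y i [yP y_ge0] neq].
  - split; last by move=> j; rewrite simpleE; case: eqP.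
    rewrite root_of_rowZ root_of_row_simple.
    by case: c1 => ->; rewrite ?mulrNz mulr1z ?al_in ?alN_in.
  - split=> //; apply: contraTneq yP => ->; rewrite scaler0; apply/negP.
    by move/Phi_neq0; rewrite /root_of_row big1 ?eqxx // => i _; rewrite mxE mulr0z.
  have yNneq : y != - simple i.
    by apply: contraTneq isT => e; have := y_ge0 i; rewrite e rowNE simple_diag.
  have [| |rP [j ji]] := root_row_reflection (i := i) yP.
  - case: c1 => ->; rewrite ?scale1r // scaleN1r.
    by apply: contra_neq yNneq => <-; rewrite opprK.
  - by case: c1 => ->; rewrite ?scale1r // scaleN1r; apply: contra_neq neq => /oppr_inj.
  rewrite reflectionZ in rP => cyj; split=> // l.
  have yj : 0 < reflection (cartan X) i y 0 j.
    rewrite reflectionE (negPf ji) subr0 lt_def y_ge0 andbT.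
    by apply: contraNneq cyj => e; rewrite rowZE e mulr0.
  have [] // : (forall l, 0 <= reflection (cartan X) i y 0 l) \/
    (forall l, reflection (cartan X) i y 0 l <= 0).
    case: c1 rP => ->; rewrite ?scale1r; first exact: root_row_sign.
    rewrite scaleN1r; case/root_row_sign => sgn; [right|left] => l';
      by have := sgn l'; rewrite rowNE ?oppr_ge0 ?oppr_le0.
  by move/(_ j); rewrite leNgt yj.
have psP := positive_unique (ps 1 (or_introl erefl)).
have psN := positive_unique (ps (-1) (or_intror erefl)).
rewrite rootsE; apply/idP/orP => [xP|[]].
- case: (root_row_sign xP) => sgn; [left; apply/psP | right; apply/psN].
    by rewrite scale1r.
  by rewrite scaleN1r opprK; split=> // j; rewrite rowNE oppr_ge0.
- by case/psP; rewrite scale1r.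
by case/psN; rewrite scaleN1r opprK.
Qed.

Lemma root_row_free a b : a \in root_vectors X -> b \in root_vectors X ->
  a + b \in root_vectors X -> free [:: toM a; toM b].
Proof.
move=> aR bR abR; have [neq neqN] := root_add_neq aR bR abR.
have [i [j minor]] := root_minor aR bR neq neqN.
apply: contraT => /not_free2[||c]; rewrite ?Phi_neq0 ?root_rowP // !root_of_rowE => e.
have row_eq l : (b 0 l)%:~R = c * (a 0 l)%:~R.
  apply/eqP; rewrite -subr_eq0; apply/eqP; move: l; apply: bl_free.
  under eq_bigr do rewrite scalerBl -scalerA.
  by rewrite sumrB -scaler_sumr e subrr.
case/eqP: minor; apply: (intr_inj_char0 char_k) => /=.
by rewrite !intrM !row_eq mulrCA mulrA mulrC.
Qed.

(** * Extension of scalars *)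

Section BaseChange.
Variables (F : fieldType) (LF : lmodType F) (brF : LF -> LF -> LF) (t : L -> F -> LF).
Hypothesis baseF : is_lie_base_change br (inIntSpan (in_tuple B)) brF t.
Local Notation S := (inIntSpan (in_tuple B)).

Let tensorP : is_tensor S t := base_change_tensor baseF.
Let tDl x y a : S x -> S y -> t (x + y) a = t x a + t y a.
Proof. by case: tensorP => -[add _] _; apply: add. Qed.

Lemma chev_span_nth m : (m < size B)%N -> S B`_m.
Proof.
move=> lt_m; exists [ffun i : 'I_(size B) => (val i == m)%:Z].
rewrite (bigD1 (Ordinal lt_m)) //= ffunE eqxx mulr1z big1 ?addr0 // => i neq.
by rewrite ffunE -[(_ == m)]/(i == Ordinal lt_m) (negPf neq) mulr0z.
Qed.

Lemma chev_span0 : S 0.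
Proof. by exists [ffun=> 0]; rewrite big1 // => i _; rewrite ffunE mulr0z. Qed.

Lemma chev_spanD x y : S x -> S y -> S (x + y).
Proof.
case=> c -> [c' ->]; exists [ffun i => c i + c' i].
by rewrite -big_split; apply: eq_bigr => i _; rewrite ffunE mulrzDr.
Qed.

Lemma chev_spanMz x (z : int) : S x -> S (x *~ z).
Proof.
case=> c ->; exists [ffun i => c i * z].
by rewrite mulrz_suml; apply: eq_bigr => i _; rewrite ffunE mulrzA.
Qed.

Lemma chev_span_sum I (s : seq I) (x : I -> L) :
  (forall i, S (x i)) -> S (\sum_(i <- s) x i).
Proof.
move=> Sx; elim: s => [|i s IHs]; last by rewrite big_cons; apply: chev_spanD.
by rewrite big_nil; apply: chev_span0.
Qed.

Let t0l a : t 0 a = 0.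
Proof.
by apply: (addIr (t 0 a)); rewrite add0r -tDl ?addr0 //; apply: chev_span0.
Qed.

Lemma tensorMz x (z : int) a : S x -> t (x *~ z) a = t x a *~ z.
Proof.
move=> Sx.
have pos m : t (x *+ m) a = t x a *+ m.
  elim: m => [|m IHm]; first by rewrite !mulr0n t0l.
  by rewrite !mulrS tDl ?IHm //; apply: (@chev_spanMz x m).
case: z => m; first exact: pos.
rewrite NegzE !mulrNz -[x *~ _]/(x *+ _) -[t x a *~ _]/(t x a *+ _) -pos.
have Sp := @chev_spanMz x m.+1 Sx; have := @chev_spanMz x (- m.+1%:Z) Sx.
rewrite mulrNz -[x *~ _]/(x *+ _) => SN.
by apply/eqP; rewrite -addr_eq0 -tDl // addNr t0l.
Qed.

Lemma tensor_sum I (s : seq I) (x : I -> L) a : (forall i, S (x i)) ->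
  t (\sum_(i <- s) x i) a = \sum_(i <- s) t (x i) a.
Proof.
move=> Sx; elim: s => [|i s IHs]; first by rewrite !big_nil t0l.
by rewrite !big_cons tDl ?IHs //; apply: chev_span_sum.
Qed.

Lemma tensorE x a : S x -> t x a = a *: t x 1.
Proof. by move=> Sx; rewrite (base_change_scale baseF) // mulr1. Qed.

(* Arbitrary outside the prime subring of k. *)
Definition to_int (c : k) : int := epsilon (inhabits 0) (fun z : int => c = z%:~R).

Lemma to_intK z : to_int z%:~R = z.
Proof.
apply: (intr_inj_char0 char_k); symmetry.
by apply: (epsilon_spec (inhabits (0 : int)) (fun z' : int => z%:~R = z'%:~R :> k)); exists z.
Qed.

Lemma chev_span_int x m : S x -> exists z : int, chev_coord m x = z%:~R.
Proof.
case=> c ->; have [lt_m|ge_m] := ltnP m (size B); last first.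
  exists 0; rewrite /chev_coord big1 // => i /eqP e.
  by move: (ltn_ord i); rewrite e ltnNge ge_m.
exists (c (Ordinal lt_m)); under eq_bigr do rewrite -scaler_int.
rewrite (scalP_sum (cs m)) (bigD1 (Ordinal lt_m)) //= chev_coordE // eqxx mulr1.
rewrite big1 ?addr0 // => i neq; rewrite chev_coordE //.
by rewrite eq_sym -[(_ == m)]/(i == Ordinal lt_m) (negPf neq) mulr0.
Qed.

Definition tensor_row (x : L) (a : F) : 'rV[F]_(size B) :=
  \row_i ((to_int (chev_coord i x))%:~R * a).

Lemma tensor_row_biadditive : biadditive_on S tensor_row.
Proof.
split=> [x y a Sx Sy|x a b Sx]; apply/rowP => i; rewrite !mxE ?mulrDr // (scalPD (cs _)).
have [z ->] := chev_span_int i Sx; have [z' ->] := chev_span_int i Sy.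
by rewrite -intrD !to_intK intrD mulrDl.
Qed.

Lemma additive_exists (U W : zmodType) (g : U -> W) :
  {morph g : x y / x + y} -> exists g' : {additive U -> W}, g' =1 g.
Proof.
move=> gD; have g0 : g 0 = 0 by apply: (addIr (g 0)); rewrite -gD !add0r.
have gB : zmod_morphism g.
  move=> x y; rewrite gD; congr (_ + _); apply/eqP.
  by rewrite -addr_eq0 -gD addNr g0.
pose g' : {additive U -> W} := HB.pack g (GRing.isZmodMorphism.Build U W g gB).
by exists g'.
Qed.

(** The existence half of the universal property turns the integral coordinates into coordinates on
    [LF]. The uniqueness half, comparing the identity with the reconstruction from coordinates,
    shows that the tensors of the basis with 1 span. *)
Lemma tensor_rowP : exists g : LF -> 'rV[F]_(size B),
  (forall w : 'rV_(size B), g (\sum_i w 0 i *: t B`_i 1) = w) /\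
  (forall u, u = \sum_i g u 0 i *: t B`_i 1).
Proof.
have [_ univ] := tensorP.
have [[g gE] _] := univ _ _ tensor_row_biadditive.
have SB (i : 'I_(size B)) : S B`_i by apply: chev_span_nth.
have [j jE] : exists j : {additive LF -> LF}, j =1 fun u => \sum_i g u 0 i *: t B`_i 1.
  apply: additive_exists => u u'; rewrite -big_split; apply: eq_bigr => i _ /=.
  by rewrite raddfD mxE scalerDl.
have [id' idE] : exists j : {additive LF -> LF}, j =1 id by apply: additive_exists.
have [_ uniq_j] := univ _ _ (tensorP.1).
exists g; split=> [w|u]; last first.
  rewrite -jE -[LHS]idE; apply: uniq_j => x a Sx; rewrite jE idE gE //.
  have [c ex] := Sx; rewrite {1}ex tensor_sum => [|i]; last exact/chev_spanMz/SB.
  apply: eq_bigr => i _; rewrite mxE -tensorE // -[RHS]/(t _ _).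
  have -> : chev_coord i x = (c i)%:~R.
    rewrite ex; under eq_bigr do rewrite -scaler_int.
    rewrite (scalP_sum (cs i)) (bigD1 i) //= chev_coordE // eqxx mulr1.
    rewrite big1 ?addr0 // => l neq; rewrite chev_coordE //.
    by rewrite eq_sym -[(_ == _)]/(l == i) (negPf neq) mulr0.
  by rewrite to_intK tensorMz // tensorE // [RHS]tensorE // -scalerA scaler_int.
rewrite raddf_sum; apply/rowP => i; rewrite summxE (bigD1 i) //= big1 => [|l neq].
  rewrite -tensorE // gE // mxE chev_coordE // eqxx -[1%:R]/(1%:~R) to_intK.
  by rewrite mul1r addr0.
rewrite -tensorE // gE // mxE chev_coordE // eq_sym -[(_ == _)]/(l == i) (negPf neq).
by rewrite -[0%:R]/(0%:~R) to_intK mul0r.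
Qed.
Lemma perm_root_rows : perm_eq Phi (map toM (root_vectors X)).
Proof.
apply: uniq_perm => [//||b].
  by rewrite map_inj_uniq ?uniq_root_vectors //; apply: root_of_row_inj.
apply/idP/mapP => [bP|[x xR ->]]; last by rewrite root_rowP.
by have [x e _] := root_row bP; exists x => //; rewrite -root_rowP -e.
Qed.

Lemma chevalley_data_exists : exists V Hh cF hF, chevalley_data (X := X) brF V Hh cF hF.
Proof.
have [g [gK gE]] := tensor_rowP.
pose E m := t B`_m 1.
pose c m u := \sum_(i < size B | val i == m) g u 0 i.
have g_lin a u u' : g (a *: u + u') = a *: g u + g u'.
  rewrite -[RHS]gK; congr g; rewrite {1}[u]gE {1}[u']gE scaler_sumr -big_split.
  by apply: eq_bigr => i _; rewrite !mxE scalerDl scalerA.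
have c_lin m : scalar (c m).
  move=> a u u'; rewrite /c mulr_sumr -big_split; apply: eq_bigr => i _ /=.
  by rewrite g_lin !mxE.
have cE m m' : (m < size B)%N -> (m' < size B)%N -> c m (E m') = (m == m')%:R.
  move=> lt_m lt_m'; rewrite /c; have -> : g (E m') = delta_mx 0 (Ordinal lt_m') :> 'rV_(size B).
    rewrite -[RHS]gK; congr g; rewrite (bigD1 (Ordinal lt_m')) //= mxE !eqxx scale1r.
    by rewrite big1 ?addr0 // => i neq; rewrite mxE (negPf neq) andbF scale0r.
  rewrite (bigD1 (Ordinal lt_m)) //= big1 ?addr0 ?mxE // => i /andP[/eqP e /eqP].
  by case; apply: val_inj.
have SE m : (m < size B)%N -> S B`_m by apply: chev_span_nth.
have Ev a : a \in Phi -> E (index a Phi) = t (v a) 1 by move=> aP; rewrite /E nth_chev_v.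
have Eh j : E (size Phi + nat_of_ord j)%N = t (hh j) 1 by rewrite /E nth_chev_h.
have Sv a : a \in Phi -> S (v a) by move=> aP; rewrite -nth_chev_v //; apply/SE/index_lt.
have Sh j : S (hh j) by rewrite -nth_chev_h; apply/SE/hindex_lt.
have brE x y : S x -> S y -> brF (t x 1) (t y 1) = t (br x y) 1.
  by move=> Sx Sy; rewrite (base_change_br baseF) // mulr1.
have tZ x (z : int) : S x -> t (z%:~R *: x) 1 = z%:~R *: t x 1.
  by move=> Sx; rewrite !scaler_int tensorMz.
have brvv a b : a \in Phi -> b \in Phi ->
    brF (t (v a) 1) (t (v b) 1) = t (br (v a) (v b)) 1.
  by move=> aP bP; apply: brE; apply: Sv.
have tZv a (z : int) : a \in Phi -> t (z%:~R *: v a) 1 = z%:~R *: t (v a) 1.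
  by move=> aP; apply/tZ/Sv.
have tnv a (m : nat) : a \in Phi -> t (m%:R *: v a) 1 = m%:R *: t (v a) 1.
  exact: (@tZv a m).
have tnNv a (m : nat) : a \in Phi -> t (- (m%:R *: v a)) 1 = - (m%:R *: t (v a) 1).
  move=> aP; rewrite -[- (_ *: v a)]scaleNr; have -> : - m%:R = (- m%:Z)%:~R :> k by rewrite mulrNz.
  by rewrite tZv // mulrNz scaleNr.
have toP x : x \in root_vectors X -> toM x \in Phi by rewrite root_rowP.
have cv_v' a b : a \in Phi -> b \in Phi -> c (index a Phi) (t (v b) 1) = (a == b)%:R.
  move=> aP bP; rewrite -Ev // cE ?index_lt //; congr (nat_of_bool _)%:R.
  by apply/eqP/eqP => [/(congr1 (nth 0 Phi))|-> //]; rewrite !nth_index.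
have cv_h' a j : a \in Phi -> c (index a Phi) (t (hh j) 1) = 0.
  move=> aP; rewrite -Eh cE ?index_lt ?hindex_lt //.
  by rewrite ltn_eqF // ltn_addr ?index_mem.
exists (fun x => t (v (toM x)) 1), (fun i => t (hh (f' i)) 1),
  (fun x => c (index (toM x) Phi)), (fun i => c (size Phi + nat_of_ord (f' i))%N).
split => //=.
- move=> u; rewrite {1}[u]gE.
  transitivity (\sum_(m < size Phi + r) c m u *: E m).
    rewrite -size_chev; apply: eq_bigr => i _; congr (_ *: _).
    by rewrite /c (bigD1 i) //= big1 ?addr0 // => j /andP[/eqP/val_inj ->]; rewrite eqxx.
  rewrite (split_basis_expand (vv := fun a => t (v a) 1) (hh := fun j => t (hh j) 1)
             (c^~ u) UPhi) //; congr (_ + _).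
    by rewrite (perm_big _ perm_root_rows) big_map.
  by rewrite (reindex f') //; exists f => ? _; [exact: f'K | exact: fK].
- by move=> a b aR bR; rewrite cv_v' ?toP // (inj_eq root_of_row_inj).
- by move=> a i aR; rewrite cv_h' ?toP.
- move=> a i aR; rewrite -Ev ?toP // cE ?index_lt ?hindex_lt ?toP //.
  by rewrite gtn_eqF // ltn_addr ?index_mem ?toP.
- move=> i j; rewrite -Eh cE ?hindex_lt // eqn_add2l -[(_ == _)]/(f' i == f' j).
  by rewrite (can_eq f'K).
- by move=> i j; rewrite brE // (chev_hh chev) t0l.
- move=> i a aR; rewrite brE ?br_h_v ?toP //; last exact/Sv/toP.
  by rewrite coroot_eval_row tZv ?toP.
- move=> a b aR bR; rewrite brvv ?toP ?rootsN // root_of_rowN.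
  (* Integrality places the bracket in the span of the h_i over the integers, so its image has no
     root component. *)
  have [l ->] := chev_opp chev (toP _ aR).
  have hE (i : 'I_r) : h`_i = hh i by rewrite (tnth_nth 0).
  rewrite tensor_sum => [|i]; last by rewrite hE; apply: chev_spanMz.
  under eq_bigr do rewrite hE tensorMz // -scaler_int.
  rewrite (scalP_sum (c_lin _)) big1 // => i _.
  by rewrite cv_h' ?toP ?mulr0.
- move=> i; rewrite brvv ?toP ?rootsN ?simple_root //.
  by rewrite root_of_rowN root_of_row_simple (chev_simple chev).
- move=> a b aR bR ab0 abR; rewrite brvv ?toP //.
  (* Here [a] and [b] may be dependent, for instance equal, so the argument is by weights and not by
     strings. *)
  suff -> : br (v (toM a)) (v (toM b)) = 0 by apply: t0l.
  apply: (weight_out (a := toM (a + b))); rewrite ?root_rowP //.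
    by rewrite root_of_rowD; apply: weight_br; apply: weight_v; apply: toP.
  by apply: contra_neq ab0 => /root_of_row_eq0.
- move=> a b aR bR abR; rewrite brvv ?toP //.
  have fab := root_row_free aR bR abR.
  have [s [q str]] := string_exists (toP _ aR) (toP _ bR).
  have [_ eq_br] := chev_string chev (toP _ aR) (toP _ bR) fab str.
  rewrite -root_of_rowD in eq_br.
  have [->|->] := eq_br (toP _ abR); [exists s.+1%:R | exists (- s.+1%:R)].
    by rewrite tnv ?toP.
  by rewrite tnNv ?toP // scaleNr.
move=> a b s aR bR abR s_in s_out; rewrite brvv ?toP //.
have fab := root_row_free aR bR abR.
have subE j : toM b - toM a *+ j = toM (b - a *+ j).
  by rewrite root_of_rowD root_of_rowN -[a *+ j]scaler_nat root_of_rowZ natz.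
have [q q_in q_out] := string_end_exists char_k (Phi_neq0 (toP _ aR)) (toP _ bR).
have str : is_string Phi (toM a) (toM b) s q.
  by split=> // [j le_j|]; rewrite subE root_rowP //; apply: s_in.
have [_ eq_br] := chev_string chev (toP _ aR) (toP _ bR) fab str.
rewrite -root_of_rowD in eq_br.
have [->|->] := eq_br (toP _ abR); [left|right].
  by rewrite tnv ?toP.
by rewrite tnNv ?toP.
Qed.
End BaseChange.

End Diagram.
End ChevalleyBasis.

Theorem theorem7
  (k : closedFieldType) (char_k : [pchar k] =i pred0)
  (L : vectType k) (br : L -> L -> L)
  (lieL : is_lie_bracket br) (simpleL : is_simple_lie br)
  (H : {vspace L}) (cartanH : is_cartan br H)
  (Phi : seq (dual H)) (PhiP : is_root_system br Phi)
  (r : nat) (alpha : r.-tuple (dual H)) (alphaP : is_base Phi alpha)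
  (v : dual H -> L) (h : r.-tuple L)
  (chev : is_chevalley_basis br Phi alpha v h)
  (X : exceptional_type) (typeX : has_dynkin_diagram br alpha X)
  (F : fieldType) (p : nat) (pF : p \in [pchar F])
  (LF : lmodType F) (brF : LF -> LF -> LF)
  (LFP : is_chevalley_algebra br Phi v h brF) :
  (forall D : LF -> LF, is_derivation brF D <-> is_inner brF D)
  <-> ~~ exceptional_case X p.
Proof.
have [t baseF] := LFP.
have lieF := base_change_lie baseF.
have [f [f' fK f'K] diagram] := typeX.
have [V [Hh [cF [hF dataF]]]] := chevalley_data_exists char_k lieL simpleL PhiP chev
  alphaP fK f'K diagram baseF.
split=> [all_inner|regular D]; last first.
  split; last exact: inner_is_derivation.
  exact: (derivation_inner lieF dataF pF regular).
apply/negP => exceptional.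
suff [D derD outer] : exists2 D, is_derivation brF D & ~ is_inner brF D.
  by apply: outer; apply/all_inner.
have natF m : (m%:R == 0 :> F) = (p %| m)%N by rewrite (dvdn_pcharf pF).
case: X {typeX f f' fK f'K diagram} exceptional V Hh cF hF dataF => // /eqP ep V Hh cF hF dataF;
  rewrite ep in pF natF.
- exact: (g2_derivation lieF dataF pF).
- apply: (degree_derivation lieF dataF (i0 := ord0) (j0 := ord0)); last rewrite mxE.
    by apply/eqP; rewrite natF.
  by rewrite -[_%:~R]/(4%:R : F) natF.
(* The last diagonal entry of the adjugate is 3; the first one, 4, serves for E6 but is 0 in
   characteristic 2. *)
- apply: (degree_derivation lieF dataF (i0 := ord_max) (j0 := ord_max)); last rewrite mxE.
    by apply/eqP; rewrite natF.
  by rewrite -[_%:~R]/(3%:R : F) natF.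
Qed.
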